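(* Let $n\ge 1$ and let $M\in\mathcal{M}_n(\mathbb{Z})$ with $\det M\neq 0$. Then for any $\varepsilon>0$ and any $T\ge 1$, $$\tau_n(T,M)\ll_{\varepsilon} T^{\lfloor n^2/2\rfloor+\varepsilon},$$ where the implied constant depends only on $\varepsilon$ and $n$ (in particular, it does not depend on $M$ or $T$).
   Context: $\mathcal{M}_n(\mathbb{Z})$ is the set of $n\times n$ integer matrices. For a matrix $A=(a_{ij})$, $|A|=\max_{i,j}|a_{ij}|$. For $T\ge 1$ and $M\in\mathcal{M}_n(\mathbb{Z})$, $$\tau_n(T,M)=\#\{(A,B)\in\mathcal{M}_n(\mathbb{Z})^2:\ |A|,|B|\le T,\ AB=M\}.$$ The notation $f\ll g$ means $|f|\le C g$ for a constant $C>0$ (the implied constant). *)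

(* Defs.v *)
From mathcomp Require Import all_boot all_order all_algebra finmap.
From mathcomp Require Import all_classical all_reals all_analysis.
Import Order.TTheory GRing.Theory Num.Theory.
Import numFieldNormedType.Exports.

Set Implicit Arguments.
Unset Strict Implicit.
Unset Printing Implicit Defensive.

Local Open Scope classical_set_scope.
Local Open Scope ring_scope.

(* On matrices `|A| is mx_norm A, the maximum of the `|A i j|. *)
Definition factorizations (R : realType) (n : nat) (T : R) (M : 'M[int]_n) :
    set ('M[int]_n * 'M[int]_n) :=
  [set AB | [/\ `|AB.1|%:~R <= T, `|AB.2|%:~R <= T & AB.1 *m AB.2 = M]].

(* fset_set sends infinite sets to fset0: see finite_factorizations. *)
Definition tau (R : realType) (n : nat) (T : R) (M : 'M[int]_n) : nat :=
  #|` fset_set (factorizations T M)|%fset.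

Lemma int_mx_normE m n (A : 'M[int]_(m, n)) :
  `|A| = \big[Num.max/0]_ij `|A ij.1 ij.2|.
Proof. exact: mx_normrE. Qed.

Lemma int_mx_norm_leP (R : realType) m n (A : 'M[int]_(m, n)) (T : R) :
  0 <= T -> `|A|%:~R <= T <-> forall i j, `|A i j|%:~R <= T.
Proof.
move=> T0; have le_floor (x : int) : (x%:~R <= T) = (x <= Num.floor T).
  by rewrite -floor_ge_int.
rewrite le_floor int_mx_normE; split=> [/bigmax_leP[_ AT] i j|AT].
  by rewrite le_floor; exact: (AT (i, j)).
apply/bigmax_leP; split=> [|[i j] _]; first by rewrite -le_floor.
by rewrite -le_floor; exact: AT.
Qed.

Lemma finite_int_mx_ball (R : realType) m n (T : R) :
  finite_set [set A : 'M[int]_(m, n) | `|A|%:~R <= T].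
Proof.
have [T0|T0] := leP 0 T; last first.
  rewrite (_ : mkset _ = set0) // -subset0 => A /= AT.
  suff : (0 : R) <= `|A|%:~R by move=> /le_trans /(_ AT); rewrite leNgt T0.
  by rewrite ler0z int_mx_normE; apply/bigmax_geP; left.
pose k := absz (Num.floor T).
pose f (B : 'M['I_(k + k).+1]_(m, n)) : 'M[int]_(m, n) :=
  \matrix_(i, j) ((B i j : nat)%:Z - k%:Z).
apply: (@sub_finite_set _ _ (f @` [set: 'M['I_(k + k).+1]_(m, n)])); last first.
  exact: finite_image.
move=> A /= /(int_mx_norm_leP _ T0) AT.
exists (\matrix_(i, j) inord (absz (A i j + k%:Z))) => //.
apply/matrixP => i j; rewrite !mxE.
have : `|A i j| <= k%:Z.
  rewrite /k gez0_abs ?floor_ge0//.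
  by rewrite floor_ge_int.
rewrite ler_norml => /andP[Ak1 Ak2].
have A0 : 0 <= A i j + k%:Z by rewrite -lerBlDr sub0r.
rewrite inordK; first by rewrite gez0_abs// addrK.
by rewrite ltnS -lez_nat gez0_abs// PoszD lerD2r.
Qed.

Lemma finite_factorizations (R : realType) n (T : R) (M : 'M[int]_n) :
  finite_set (factorizations T M).
Proof.
apply: sub_finite_set (finite_setX (finite_int_mx_ball n n T)
                                  (finite_int_mx_ball n n T)).
by move=> [A B] [].
Qed.

(* Main.v *)
Require Import Defs.
From mathcomp Require Import all_boot all_order all_algebra all_fingroup finmap.
From mathcomp Require Import all_classical all_reals all_analysis.
From mathcomp Require Import zify ring lra.
Set Implicit Arguments.
Unset Strict Implicit.
Unset Printing Implicit Defensive.
Import Order.TTheory GRing.Theory Num.Theory.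

(** As det M <> 0, the factor A determines B, so it suffices to count left
    factors. They are grouped by the column lattice A Z^n: A and A' generate
    the same lattice when each is an integer matrix multiple of the other on
    the right. Put S = floor(n^2/4), D = |det M| and N = floor T. Up to factors
    that are smaller than any power of N,

    - the number of lattices is at most D^(S/n) ([count_divisor_classes]);
    - one lattice has at most (N^(2n)/D)^(S/n) generators A for which A and
      A^-1 M are bounded by N ([count_class]).

    The powers of D cancel in the product ([split_classes]), and what is left
    is N^(2S), where 2S = floor(n^2/2).

    Lattices. A lattice A Z^n that contains M Z^n is the kernel of a surjection
    of Z^n onto a group Q = Z/e_1 + ... + Z/e_n that kills M. If h_1, ..., h_n
    are the elementary divisors of M, there are prod_ij gcd(e_i, h_j)
    homomorphisms from Z^n to Q that kill M, and each lattice with quotient Q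
    is the kernel of at least #Aut(Q) of them. The automorphisms that are
    products of a lower unipotent, a diagonal and an upper unipotent matrix are
    numerous enough: they number prod_ij gcd(e_i, e_j) up to divisor functions.

    Generators of one lattice. Gaussian elimination with complete pivoting and
    with rounding ([pivoted_reduction]) writes A as diag(b) G^-1 k up to a
    permutation of the rows, where the b_i are dyadic scales, G is an integer
    lower unipotent matrix, and k and k^-1 are bounded. There are few scales
    ([reduces_scale]), and generators of the same lattice with the same scales
    and the same G differ by a bounded integer matrix. The entries of G are
    restricted twice: by the elimination, and because G diag(b)^-1 M = k B has
    entries of size O(N).

    Both exponents S/n come from one inequality, [sum_minn_le]. In the first
    count it is applied to the valuations of the e_i and of the h_j at each
    prime, in the second one to the binary logarithms of the scales b_i and of
    the diagonal of a triangular form of M.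

    The divisor functions and the powers of log N are absorbed by [ndiv_bound]
    and [expS_le_exp2]. To remain within the natural numbers, all counts are
    raised to the power n q, with q of the order of 1/eps. *)

(** * The exponent inequality *)

(** Since 4 k l <= (k + l)^2, the inequality with n^2/4 instead of its floor
    is immediate. For odd n the floor is reached because k and l are integers:
    either k + l = n and k l is at most the floor, or k + l <= n - 1 and
    n (n - 1) / 4 is below the floor. *)
Lemma mul_le_quarter_sq n k l :
  k + l <= n -> n * (k * l) <= (n ^ 2 %/ 4) * (k + l).
Proof.
move=> le_kl; set a := n./2; set s := k + l in le_kl *.
have k4 : 4 * (k * l) <= s ^ 2 by case: (nat_AGM2 k l).
rewrite -mulnn in k4.
have [n_even|n_odd] : n = 2 * a \/ n = 2 * a + 1 by rewrite /a; lia.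
  have -> : n ^ 2 %/ 4 = a ^ 2 by rewrite n_even expnMn mulKn.
  have : s * s <= s * (2 * a) by rewrite leq_mul2l; lia.
  by nia.
have -> : n ^ 2 %/ 4 = a * a.+1.
  by rewrite (_ : n ^ 2 = a * a.+1 * 4 + 1) ?divnMDl ?addn0// n_odd -mulnn; lia.
have [s_le|s_eq] : s <= 2 * a \/ s = 2 * a + 1 by lia.
  have : s * s <= s * (2 * a) by rewrite leq_mul2l; lia.
  by nia.
have : k * l <= a * a.+1 by nia.
by rewrite s_eq n_odd; nia.
Qed.

(** Layer-cake formula, by which inequalities between sums of minima can be
    proved separately at each height t. *)
Lemma minn_sum_thresholds N a b : a <= N ->
  minn a b = \sum_(t < N) (t < a) * (t < b).
Proof.
move=> aN.
have -> : \sum_(t < N) (t < a) * (t < b) = \sum_(t < N | t < minn a b) 1.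
  rewrite [RHS]big_mkcond/=; apply: eq_bigr => t _.
  by rewrite leq_min; case: (_ < a); case: (_ < b).
have abN : minn a b <= N by rewrite geq_min aN.
by rewrite -(big_ord_widen _ (fun=> 1) abN) sum1_card card_ord.
Qed.

(** At height t, with k = #{i | t < p i} and m = #{j | t < r j}, the three
    sums contribute n k m, n k^2 and floor(n^2/4) m. So the claim is
    n k (m - k) <= floor(n^2/4) m, which is [mul_le_quarter_sq] for the
    numbers k and m - k, whose sum m is at most n. *)
Lemma sum_minn_le n (p r : 'I_n -> nat) :
  n * (\sum_i \sum_j minn (p i) (r j))
    <= n * (\sum_i \sum_j minn (p i) (p j)) + (n ^ 2 %/ 4) * \sum_j r j.
Proof.
pose N := \sum_i (p i + r i).
have bndN i : p i + r i <= N by rewrite /N (bigD1 i)//= leq_addr.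
have pN i : p i <= N by apply: leq_trans (bndN i); apply: leq_addr.
have rN i : r i <= N by apply: leq_trans (bndN i); apply: leq_addl.
pose k t := \sum_i (t < p i); pose m t := \sum_i (t < r i).
have sum_min (q : 'I_n -> nat) :
    \sum_i \sum_j minn (p i) (q j) = \sum_(t < N) k t * \sum_j (t < q j).
  transitivity (\sum_i \sum_j \sum_(t < N) (t < p i) * (t < q j)).
    by apply: eq_bigr => i _; apply: eq_bigr => j _; apply: minn_sum_thresholds.
  rewrite (eq_bigr _ (fun i _ => exchange_big _ _ _ _ _ _))/= exchange_big/=.
  apply: eq_bigr => t _; rewrite big_distrl/=.
  by apply: eq_bigr => i _; rewrite big_distrr.
have -> : \sum_j r j = \sum_(t < N) m t.
  rewrite exchange_big/=; apply: eq_bigr => j _.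
  rewrite -[LHS]minnn (minn_sum_thresholds _ (rN j)).
  by apply: eq_bigr => t _; case: (_ < _).
rewrite !sum_min !big_distrr/= -big_split/=; apply: leq_sum => t _.
rewrite -/(k t) -/(m t).
have lt_n (q : 'I_n -> nat) : \sum_i (t < q i) <= n.
  rewrite -[leqRHS]card_ord -sum1_card.
  by apply: leq_sum => i _; case: (_ < _).
have [mk|km] := leqP (m t) (k t).
  by apply: leq_trans (leq_addr _ _); rewrite !leq_mul2l mk !orbT.
have := @mul_le_quarter_sq n (k t) (m t - k t).
rewrite subnKC ?(ltnW km)// (lt_n r) => /(_ isT); rewrite mulnBr mulnBr leq_subLR.
by [].
Qed.

(** Powers of a logarithm are negligible: P plays the role of log N. The
    reason is that (P + 1)^k / k! <= C(P + k, k) <= 2^(P + k). *)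
Lemma expS_le_exp2 k P : P.+1 ^ k <= k`! * 2 ^ (P + k).
Proof.
have bin_le n m : 'C(n, m) <= 2 ^ n.
  have [mn|nm] := leqP m n; last by rewrite bin_small.
  rewrite -[2]/(1 + 1) expnDn (bigD1 (Ordinal (mn : m < n.+1)))//=.
  by rewrite !exp1n !muln1 leq_addr.
apply: (@leq_trans ((P + k) ^_ k)); last first.
  by rewrite -bin_ffact mulnC leq_mul2l bin_le orbT.
rewrite ffact_prod -[X in _ ^ X]card_ord -prod_nat_const.
by apply: leq_prod => i _; have := ltn_ord i; lia.
Qed.

(** * The divisor bound *)

Definition ndiv m := size (divisors m).

Lemma leqXr e m n : m <= n -> m ^ e <= n ^ e.
Proof. by move=> mn; elim: e => // e IH; rewrite !expnS leq_mul. Qed.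

Lemma prodnX (I : finType) (F : I -> nat) k :
  (\prod_i F i) ^ k = \prod_i F i ^ k.
Proof. by elim/big_rec2: _ => [|i a b _ <-]; rewrite ?exp1n// expnMn. Qed.

Lemma card_familyE (aT rT : finType) (F : aT -> pred rT) :
  #|family F| = \prod_x #|F x|.
Proof. by rewrite card_family/= foldrE big_map big_enum. Qed.

Lemma card_ord_lt m a : a <= m -> #|[pred x : 'I_m | x < a]| = a.
Proof.
by move=> am; rewrite -sum1_card -(big_ord_widen _ (fun=> 1) am) sum1_card card_ord.
Qed.

(** A divisor of m is determined by its valuations, and the one at p takes
    its values in 0, ..., v_p(m). *)
Lemma ndiv_le_prod_logn m : 0 < m -> ndiv m <= \prod_(p < m.+1) (logn p m).+1.
Proof.
move=> m_gt0.
pose F (p : 'I_m.+1) : pred 'I_m.+1 := [pred v : 'I_m.+1 | v < (logn p m).+1].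
have logm p : logn p m <= m by apply/ltnW/ltn_logl.
have -> : \prod_(p < m.+1) (logn p m).+1 = #|family F|.
  by rewrite card_familyE; apply: eq_bigr => p _; rewrite card_ord_lt// ltnS.
pose g d : {ffun 'I_m.+1 -> 'I_m.+1} := [ffun p : 'I_m.+1 => inord (logn p d)].
rewrite /ndiv -(size_map g) cardE; apply: uniq_leq_size.
  rewrite map_inj_in_uniq ?divisors_uniq// => d d'.
  rewrite -!dvdn_divisors// => dm d'm /ffunP eq_g.
  have [d_gt0 d'_gt0] := (dvdn_gt0 m_gt0 dm, dvdn_gt0 m_gt0 d'm).
  have small e : e %| m -> forall p, logn p e < m.+1.
    by move=> em p; rewrite ltnS (leq_trans (dvdn_leq_log p m_gt0 em)).
  apply: eqn_from_log => // p.
  have [pm|mp] := ltnP p m.+1.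
    have := eq_g (Ordinal pm); rewrite !ffunE => /(congr1 val)/=.
    by rewrite !inordK ?small.
  by rewrite !ltn_log0// (leq_ltn_trans (dvdn_leq m_gt0 _) mp).
move=> f /mapP[d]; rewrite -dvdn_divisors// => dm ->.
rewrite mem_enum; apply/familyP => p; rewrite ffunE inE.
have lem := dvdn_leq_log p m_gt0 dm.
by rewrite inordK ltnS// (leq_trans lem).
Qed.

(** The divisor bound d(m) << m^(1/k). A prime p >= 2^k contributes
    (v + 1)^k <= 2^(k v) <= p^v to the left hand side, without a constant; each
    of the finitely many smaller primes costs a factor k! 2^k by
    [expS_le_exp2]. *)
Lemma ndiv_bound k : exists C, forall m, 0 < m -> ndiv m ^ k <= C * m.
Proof.
pose K := k`! * 2 ^ k.
have K_gt0 : 0 < K by rewrite muln_gt0 fact_gt0 expn_gt0.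
pose c p := if p < 2 ^ k then K else 1.
exists (\prod_(p < 2 ^ k) K) => m m_gt0.
apply: (@leq_trans (\prod_(p < m.+1) (c p * p ^ logn p m))).
  apply: (leq_trans (leqXr _ (ndiv_le_prod_logn m_gt0))).
  rewrite prodnX; apply: leq_prod => p _; rewrite /c.
  have [p_pr|p_npr] := boolP (prime p); last first.
    by rewrite lognE (negPf p_npr)/= exp1n expn0 muln1; case: ifP.
  have [_|p_big] := ifPn; last first.
    rewrite mul1n -leqNgt in p_big *.
    apply: (@leq_trans ((2 ^ k) ^ logn p m)); last exact: leqXr.
    by rewrite -expnM mulnC expnM leqXr// ltn_expl.
  apply: (leq_trans (expS_le_exp2 _ _)); rewrite expnD mulnA mulnAC leq_mul2l.
  by rewrite leqXr ?prime_gt1// orbT.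
rewrite big_split/= leq_mul//; last first.
  rewrite -[leqRHS](partnT m_gt0) /partn big_mkord.
  by apply: eq_leq; apply: eq_bigl.
pose N := maxn m.+1 (2 ^ k).
have -> : \prod_(p < 2 ^ k) K = \prod_(p < N | p < 2 ^ k) K.
  by rewrite (big_ord_widen _ (fun=> K) (leq_maxr m.+1 (2 ^ k))).
rewrite (big_ord_widen _ c (leq_maxl m.+1 (2 ^ k))) !(big_mkcond (fun _ => _ < _))/=.
by apply: leq_prod => p _; rewrite /c; case: ifP; case: ifP.
Qed.

Lemma leq_ndiv m n : 0 < n -> m %| n -> ndiv m <= ndiv n.
Proof.
move=> n_gt0 mn; have m_gt0 := dvdn_gt0 n_gt0 mn.
apply: uniq_leq_size; first exact: divisors_uniq.
by move=> d; rewrite -!dvdn_divisors// => /dvdn_trans ->.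
Qed.

(** The divisors d of m and their multiples p d are all distinct. *)
Lemma ndiv_primeM p v m : prime p -> coprime p m -> 0 < m ->
  2 * ndiv m <= ndiv (p ^ v.+1 * m).
Proof.
move=> p_pr cop m_gt0; have p_gt0 := prime_gt0 p_pr.
rewrite /ndiv mul2n -addnn -{2}(size_map (muln p)) -size_cat.
apply: uniq_leq_size.
  rewrite cat_uniq divisors_uniq map_inj_uniq ?divisors_uniq ?andbT/=; last first.
    by move=> a b /eqP; rewrite eqn_pmul2l// => /eqP.
  apply/hasPn => _ /mapP[d _ ->]; rewrite -dvdn_divisors//.
  apply/negP => /(dvdn_trans (dvdn_mulr d (dvdnn p))).
  by apply/negP; rewrite -prime_coprime.
move=> d; rewrite -dvdn_divisors ?muln_gt0 ?expn_gt0 ?p_gt0// mem_cat.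
case/orP => [|/mapP[d' + ->]]; rewrite -dvdn_divisors// => dm.
  exact: dvdn_mull.
by apply: dvdn_mul => //; rewrite expnS dvdn_mulr.
Qed.

(** The quotient e / phi(e) is the product of the p / (p - 1) <= 2 over the
    primes p that divide e, and there are at least as many divisors as subsets
    of this set of primes. *)
Lemma leq_totient_ndiv e : 0 < e -> e <= totient e * ndiv e.
Proof.
have [k] := ubnP e; elim: k e => // k IH e /ltnSE ek e_gt0.
have [|e_gt1] := leqP e 1; first by case: e e_gt0 {ek} => [|[]].
pose p := pdiv e; have p_pr : prime p by apply: pdiv_prime.
have [m cop def_e] := pfactor_coprime p_pr e_gt0.
have p_gt1 := prime_gt1 p_pr.
have m_gt0 : 0 < m by move: e_gt0; rewrite def_e muln_gt0 => /andP[].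
have : 0 < logn p e by rewrite logn_gt0 mem_primes p_pr e_gt0 pdiv_dvd.
move: def_e; case: (logn p e) => // v def_e _.
have lt_me : m < e.
  rewrite [leqRHS]def_e -{1}[m]muln1 ltn_pmul2l// expnS.
  by rewrite (leq_trans p_gt1) ?leq_pmulr// expn_gt0 ltnW.
have m_le := IH m (leq_trans lt_me ek) m_gt0.
have d_le := ndiv_primeM v p_pr cop m_gt0.
rewrite def_e mulnC totient_coprime ?coprimeXl// totient_pfactor//= expnS.
apply: (@leq_trans (2 * p.-1 * p ^ v * (totient m * ndiv m))).
  by apply: leq_mul => //; rewrite leq_mul2r; apply/orP; right; lia.
rewrite -expnS.
set a := p.-1; set b := p ^ v; set c := totient m.
rewrite (_ : 2 * a * b * _ = a * b * c * (2 * ndiv m)); last by lia.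
by rewrite leq_mul2l d_le orbT.
Qed.

(** * Arithmetic of products of gcds *)

Lemma logn_prodn (I : finType) (F : I -> nat) p :
  (forall i, 0 < F i) -> logn p (\prod_i F i) = \sum_i logn p (F i).
Proof.
move=> F_gt0.
suff [_ ->//] : 0 < \prod_i F i /\ logn p (\prod_i F i) = \sum_i logn p (F i).
apply: (big_rec2 (fun (a s : nat) => 0 < a /\ logn p a = s)); first by rewrite logn1.
by move=> i a b _ [a_gt0 <-]; rewrite lognM// muln_gt0 F_gt0.
Qed.

Lemma dvdn_from_logn m n : 0 < m -> 0 < n ->
  (forall p, logn p m <= logn p n) -> m %| n.
Proof.
move=> m_gt0 n_gt0 le_log; apply/dvdn_partP => // p.
rewrite mem_primes => /and3P[p_pr _ _].
by rewrite p_part pfactor_dvdn.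
Qed.

(** The left hand side even divides the right hand side: at a given prime the
    valuation turns each gcd into a minimum, and the comparison of exponents is
    [sum_minn_le]. *)
Lemma prod_gcdn_le n (e h : 'I_n -> nat) :
  (forall i, 0 < e i) -> (forall i, 0 < h i) ->
  (\prod_i \prod_j gcdn (e i) (h j)) ^ n <=
    (\prod_i \prod_j gcdn (e i) (e j)) ^ n * (\prod_j h j) ^ (n ^ 2 %/ 4).
Proof.
move=> e_gt0 h_gt0.
have pos (g : 'I_n -> nat) : (forall i, 0 < g i) ->
    forall i, 0 < \prod_j gcdn (e i) (g j).
  by move=> g_gt0 i; apply: prodn_gt0 => j; rewrite gcdn_gt0 e_gt0.
have logE (g : 'I_n -> nat) p : (forall i, 0 < g i) ->
    logn p (\prod_i \prod_j gcdn (e i) (g j)) =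
    \sum_i \sum_j minn (logn p (e i)) (logn p (g j)).
  move=> g_gt0; rewrite logn_prodn; last exact: pos.
  apply: eq_bigr => i _; rewrite logn_prodn => [|j]; last by rewrite gcdn_gt0 e_gt0.
  by apply: eq_bigr => j _; rewrite logn_gcd.
have gt0 (g : 'I_n -> nat) : (forall i, 0 < g i) ->
    0 < \prod_i \prod_j gcdn (e i) (g j).
  by move=> g_gt0; apply: prodn_gt0 => i; apply: pos.
have rhs_gt0 : 0 < (\prod_i \prod_j gcdn (e i) (e j)) ^ n * (\prod_j h j) ^ (n ^ 2 %/ 4).
  by rewrite muln_gt0 !expn_gt0 gt0// prodn_gt0.
apply/dvdn_leq => //; apply: dvdn_from_logn => // [|p].
  by rewrite expn_gt0 gt0.
rewrite lognM ?expn_gt0 ?gt0 ?prodn_gt0// !lognX !logE// logn_prodn//.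
exact: sum_minn_le.
Qed.

(** * Counting by pigeonhole *)

Lemma bigmax_attained (U : eqType) (vals : seq U) (f : U -> nat) : vals != [::] ->
  exists2 v, v \in vals & \max_(u <- vals) f u = f v.
Proof.
elim: vals => // u [_ _|w vals /(_ isT)[v v_in max_v] _].
  by exists u; rewrite ?mem_head// big_seq1.
rewrite big_cons max_v; case: (leqP (f u) (f v)) => _.
  by exists v; rewrite // in_cons v_in orbT.
by exists u; rewrite // mem_head.
Qed.

Lemma pigeonhole (T U : eqType) (s : seq T) (h : T -> U) (vals : seq U) :
  {in s, forall x, h x \in vals} -> s != [::] ->
  exists2 v, v \in vals & size s <= size vals * size [seq x <- s | h x == v].
Proof.
move=> h_in s_neq0.
have vals_neq0 : vals != [::].
  case: s h_in s_neq0 => // x s /(_ x (mem_head _ _)) + _.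
  by case: vals.
have [v v_in max_v] := bigmax_attained (fun v => size [seq x <- s | h x == v]) vals_neq0.
exists v => //; rewrite -{}max_v.
have : size s <= \sum_(v <- vals) size [seq x <- s | h x == v].
  elim: s h_in {s_neq0} => //= x s IH h_in.
  have hx : h x \in vals by apply: h_in; apply: mem_head.
  rewrite (eq_bigr (fun v => (h x == v) + size [seq x <- s | h x == v])).
    rewrite big_split/= -[_.+1]add1n leq_add ?IH//; last first.
      by move=> y ys; apply: h_in; rewrite in_cons ys orbT.
    by rewrite (big_rem _ hx)/= eqxx.
  by move=> u _; case: eqP.
move=> /leq_trans; apply.
apply: (@leq_trans (\sum_(v <- vals) \max_(u <- vals) size [seq x <- s | h x == u])).
  by rewrite big_seq [leqRHS]big_seq; apply: leq_sum => u u_in; apply: leq_bigmax_seq.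
by rewrite big_const_seq count_predT iter_addn_0 mulnC.
Qed.

Local Open Scope ring_scope.

(** Such integers are pairwise distinct modulo l. *)
Lemma size_close_ints l (s : seq int) : uniq s ->
  {in s &, forall x y, (absz (x - y) < l)%N} -> (size s <= l)%N.
Proof.
move=> uniq_s close; case: s => // x0 s' in uniq_s close *; set s := x0 :: s' in uniq_s close *.
have l_gt0 : (0 < l)%N.
  by rewrite (leq_ltn_trans _ (close x0 x0 (mem_head _ _) (mem_head _ _))).
have modl (x : int) : (0 <= (x %% l)%Z < l%:Z).
  by rewrite modz_ge0 ?ltz_pmod ?gt_eqF.
rewrite -(size_iota 0 l) -(size_map (fun x : int => absz (x %% l)%Z)).
apply: uniq_leq_size.
  rewrite map_inj_in_uniq// => x y xs ys eq_mod.
  have : (x %% l = y %% l)%Z.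
    by have /andP[x0' _] := modl x; have /andP[y0' _] := modl y; rewrite -(gez0_abs x0') -(gez0_abs y0') eq_mod.
  move/eqP; rewrite eqz_mod_dvd dvdzE/= => /dvdnP[[|q] q_eq].
    by apply/eqP; rewrite -subr_eq0 -absz_eq0 q_eq.
  have := close x y xs ys; rewrite q_eq mulSn => /(leq_ltn_trans (leq_addr _ _)).
  by rewrite ltnn.
by move=> _ /mapP[x _ ->]; rewrite mem_iota/= add0n; have := modl x; lia.
Qed.

(** The values of the f c are fixed one after the other, in the order of cs,
    each time keeping a fibre of S of at least average size. The window that
    confines f c may move with the previous values; only its length l c has to
    be uniform. This is what triangular systems provide. *)
Lemma seq_count (X I : eqType) (f : I -> X -> int) (l : I -> nat) B
    (cs : seq I) (S : seq X) :
  (forall cs1 c cs2, cs = cs1 ++ c :: cs2 -> {in S &, forall x y,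
     {in cs1, forall c', f c' x = f c' y} -> (absz (f c x - f c y) < l c)%N}) ->
  (forall S', subseq S' S -> {in S' &, forall x y, {in cs, forall c, f c x = f c y}} ->
     (size S' <= B)%N) ->
  (size S <= B * \prod_(c <- cs) l c)%N.
Proof.
elim: cs S => [|c cs IH] S close fib.
  by rewrite big_nil muln1 fib.
have [->//|S_neq0] := eqVneq S [::].
have [|v _ size_S] := @pigeonhole _ _ S (f c) (undup (map (f c) S)) _ S_neq0.
  by move=> x xS; rewrite mem_undup map_f.
apply: leq_trans size_S _.
rewrite big_cons mulnCA leq_mul//.
  apply: size_close_ints; first exact: undup_uniq.
  move=> u w; rewrite !mem_undup => /mapP[x xS ->] /mapP[y yS ->].
  by apply: (close [::] c cs).
apply: IH => [cs1 c' cs2 cs_eq x y|S' sub_S' eq_S'].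
  rewrite !mem_filter => /andP[/eqP fx xS] /andP[/eqP fy yS] eq_cs1.
  apply: (close (c :: cs1) c' cs2) => //; first by rewrite cs_eq.
  by move=> c''; rewrite inE => /predU1P[->|/eq_cs1//]; rewrite fx fy.
apply: fib => [|x y xS yS c']; first by apply: subseq_trans sub_S' (filter_subseq _ _).
rewrite inE => /predU1P[->|]; last exact: eq_S'.
have := mem_subseq sub_S' xS; have := mem_subseq sub_S' yS.
by rewrite !mem_filter => /andP[/eqP-> _] /andP[/eqP-> _].
Qed.

(** * Smith form and homomorphism counting *)

Lemma absz_det_unitmx n (K : 'M[int]_n) : K \in unitmx -> absz (\det K) = 1%N.
Proof. by rewrite unitmxE => /orP[]/eqP->. Qed.

(** The signs of the invariant factors are moved into U, which leaves natural
    numbers on the diagonal. *)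
Lemma int_Smith_square n (A : 'M[int]_n) : \det A != 0 ->
  exists K U (e : 'I_n -> nat),
    [/\ K \in unitmx, U \in unitmx,
        K *m A = diag_mx (\row_i (e i)%:Z) *m U,
        (forall i j : 'I_n, (i <= j)%N -> (e i %| e j)%N) &
        (\prod_i e i)%N = absz (\det A)].
Proof.
have [L uL [R uR [d d_sorted defA]]] := int_Smith_normal_form A => detA.
set D := \matrix_(i, j) _ in defA.
have defD : D = diag_mx (\row_i d`_i).
  by apply/matrixP => i j; rewrite !mxE val_eqE.
have detAE : absz (\det A) = (\prod_(i < n) absz (d`_i)%R)%N.
  rewrite defA !det_mulmx !abszM (absz_det_unitmx uL) (absz_det_unitmx uR).
  rewrite mul1n muln1 defD det_diag.
  by elim/big_rec2: _ => // i a b _ <-; rewrite abszM mxE.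
have d_neq0 (i : 'I_n) : d`_i != 0.
  move: detA; rewrite -absz_eq0 detAE; apply: contraNneq => di0.
  by rewrite (bigD1 i)//= di0 mul0n.
pose U := diag_mx (\row_i sgz d`_i) *m R.
exists (invmx L), U, (fun i => absz d`_i); split.
- by rewrite unitmx_inv.
- rewrite unitmx_mul uR andbT unitmxE det_diag unitr_prod// => i _.
  by rewrite mxE; case: sgzP (d_neq0 i).
- rewrite /U mulmxA defA -mulmxA mulKmx// defD; congr (_ *m _).
  rewrite mulmx_diag; congr diag_mx; apply/rowP => i; rewrite !mxE.
  by rewrite mulrC -intEsg.
- move=> i j ij; rewrite -[(_ %| _)%N]/(dvdz _ _).
  apply: (sorted_leq_nth dvdz_trans dvdzz) => //; rewrite inE ltnNge;
    by apply/negP => /(nth_default 0) /eqP; rewrite (negPf (d_neq0 _)).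
- by rewrite detAE.
Qed.

Lemma natr_ord_eq0 F k : (k%:R == 0 :> 'I_F.+2) = (F.+2 %| k)%N.
Proof. by rewrite -(inj_eq val_inj) [val _](@val_Zp_nat F.+2 isT k). Qed.

Lemma intr_ord_eq0 F (m : int) : (m%:~R == 0 :> 'I_F.+2) = (F.+2 %| absz m)%N.
Proof.
by case: m => m; rewrite ?NegzE ?mulrNz ?oppr_eq0 ?abszN natr_ord_eq0.
Qed.

Lemma dvdn_mod d m n : (d %| m)%N -> (d %| n %% m)%N = (d %| n)%N.
Proof. by move=> dm; rewrite /dvdn modn_dvdm. Qed.

(** Homomorphisms into Q = Z/e_1 + ... + Z/e_n are represented by matrices over
    one single ring Z/E, for a common multiple E of the e_k: multiplication by
    c k = E / e_k embeds Z/e_k into Z/E. *)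
Section ElementaryDivisorCount.
Variables (F n : nat) (e : 'I_n -> nat).
Let E := F.+2.
Hypothesis e_dvdE : forall i, (e i %| E)%N.
Hypothesis e_chain : forall i j : 'I_n, (i <= j)%N -> (e i %| e j)%N.

Let c k : 'I_E := (E %/ e k)%:R.

Let e_gt0 k : (0 < e k)%N.
Proof. exact: dvdn_gt0 (e_dvdE k). Qed.

Let c_eq0 k (x : 'I_E) : (c k * x == 0) = (e k %| x)%N.
Proof.
rewrite -[x in c k * x]natr_Zp -natrM natr_ord_eq0.
rewrite -/E -{1}(divnK (e_dvdE k)) dvdn_pmul2l//.
by rewrite divn_gt0// dvdn_leq.
Qed.

(** A function f of pairs of indices holds the coefficients of a lower unipotent
    matrix (below the diagonal), of a diagonal matrix (on it) and of an upper
    unipotent matrix (above it). *)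
Definition lower_part (f : {ffun 'I_n * 'I_n -> 'I_E}) : 'M['I_E]_n :=
  \matrix_(i, j) if (j < i)%N then f (i, j) else (i == j)%:R.
Definition upper_part (f : {ffun 'I_n * 'I_n -> 'I_E}) : 'M['I_E]_n :=
  \matrix_(i, j) if (i < j)%N then f (i, j) else (i == j)%:R.

(** The factor c k on the diagonal makes row i of the product a row of elements
    of Z/e_i embedded in Z/E: this is the matrix of an endomorphism of Q. *)
Definition LDU (f : {ffun 'I_n * 'I_n -> 'I_E}) : 'M['I_E]_n :=
  lower_part f *m diag_mx (\row_k (c k * f (k, k))) *m upper_part f.

(** The entry (i, j) is only relevant modulo e_min(i, j), since column i of the
    lower part and row i of the upper part are multiplied by c i. The diagonal
    entries have to be units for the product to be an automorphism of Q. *)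
Definition LDU_domain (ij : 'I_n * 'I_n) : pred 'I_E :=
  if ij.1 == ij.2 then [pred x : 'I_E | (x < e ij.1)%N && coprime (e ij.1) x]
  else [pred x : 'I_E | (x < e (if (ij.1 < ij.2)%N then ij.1 else ij.2))%N].

Let e_dvdM k (x y : 'I_E) : (e k %| (x * y)%R)%N = (e k %| x * y)%N.
Proof. by rewrite /= dvdn_mod. Qed.

Let e_dvdD k (x y : 'I_E) : (e k %| x)%N -> (e k %| (x + y)%R)%N = (e k %| y)%N.
Proof. by move=> kx; rewrite /= dvdn_mod// dvdn_addr. Qed.

Let e_dvd_sum k I (r : seq I) (P : pred I) (G : I -> 'I_E) :
  (forall i, P i -> (e k %| G i)%N) -> (e k %| (\sum_(i <- r | P i) G i)%R)%N.
Proof.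
move=> kG; apply: (big_ind (fun x : 'I_E => e k %| x)%N) => // x y kx ky.
by rewrite e_dvdD.
Qed.

Let unit_lower f : lower_part f \in unitmx.
Proof.
rewrite unitmxE det_trig ?big1 ?unitr1// => [i _|]; first by rewrite mxE ltnn eqxx.
apply/is_trig_mxP => i j ij.
by rewrite mxE ltnNge ltnW//= -val_eqE (ltn_eqF ij).
Qed.

(** The endomorphism of Q with matrix LDU f is injective. The lower factor is
    invertible over Z/E and the diagonal entries are units modulo e_k, so e_k
    divides the k-th coordinate of upper_part f y. Back substitution from the
    last coordinate gives the same for y, because e_k divides e_j for k < j. *)
Lemma LDU_kernel f (y : 'cV['I_E]_n) : f \in family LDU_domain ->
  LDU f *m y = 0 -> forall k, (e k %| y k ord0)%N.
Proof.
move=> /familyP fP.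
rewrite /LDU -!mulmxA => /(congr1 (mulmx (invmx (lower_part f)))).
rewrite mulKmx// mulmx0 => /colP Dy0.
have Uy k : (e k %| (upper_part f *m y)%R k ord0)%N.
  have := Dy0 k; rewrite mul_diag_mx mxE mxE [in RHS]mxE -mulrA => /eqP.
  rewrite c_eq0 e_dvdM.
  have := fP (k, k); rewrite /LDU_domain/= eqxx inE => /andP[_ cop].
  by rewrite Gauss_dvdr.
move=> k; have [m] := ubnP (n - k)%N; elim: m k => // m IH k mk.
have UyE : (upper_part f *m y) k ord0 =
    \sum_(j | j != k) upper_part f k j * y j ord0 + y k ord0.
  by rewrite mxE (bigD1 k)//= mxE ltnn eqxx mul1r addrC.
have := Uy k; rewrite UyE e_dvdD//.
apply: e_dvd_sum => j jk; rewrite mxE.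
have [kj|jk'] := ltnP k j; last first.
  by rewrite (_ : (k == j) = false) ?mul0r ?dvdn0// eq_sym (negPf jk).
rewrite e_dvdM dvdn_mull// (dvdn_trans (e_chain (ltnW kj)))// IH//.
by have := ltn_ord j; lia.
Qed.

Let c_cancel k (d x y : 'I_E) : coprime (e k) d -> (x < e k)%N -> (y < e k)%N ->
  x * (c k * d) = y * (c k * d) -> x = y.
Proof.
move=> cop xk yk /eqP; rewrite -subr_eq0 -mulrBl mulrCA c_eq0 e_dvdM Gauss_dvdl// => kxy.
apply/val_inj => /=; rewrite -(modn_small xk) -(modn_small yk).
rewrite -{1}(subrK y x) -[nat_of_ord (_ + _)%R]/((nat_of_ord (x - y)%R + y) %% E)%N.
by rewrite modn_dvdm// -modnDml (eqP kxy) add0n.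
Qed.

Let lower_part0 f (i l : 'I_n) : (i < l)%N -> lower_part f i l = 0.
Proof. by move=> il; rewrite mxE ltnNge ltnW//= -val_eqE (ltn_eqF il). Qed.

Let upper_part0 f (l j : 'I_n) : (j < l)%N -> upper_part f l j = 0.
Proof. by move=> jl; rewrite mxE ltnNge ltnW//= -val_eqE (gtn_eqF jl). Qed.

Let LDUE f i j : LDU f i j =
  \sum_l lower_part f i l * (c l * f (l, l)) * upper_part f l j.
Proof.
rewrite /LDU mxE; apply: eq_bigr => l _.
by rewrite mul_mx_diag; congr (_ * _); rewrite !mxE.
Qed.

(** Uniqueness of the decomposition, by induction on min(i, j): the entry (i, j)
    of LDU f involves f only up to the index min(i, j), and f (i, j) itself
    through a single term, in which its coefficient is c times a unit. *)
Lemma LDU_inj : {in family LDU_domain &, injective LDU}.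
Proof.
move=> f g /familyP fP /familyP gP eq_fg.
pose T h (i j l : 'I_n) : 'I_E :=
  lower_part h i l * (c l * h (l, l)) * upper_part h l j.
suff eq_ij m (i j : 'I_n) : (minn i j < m)%N -> f (i, j) = g (i, j).
  by apply/ffunP => -[i j]; apply: (eq_ij (minn i j).+1).
elim: m i j => // m IH i j ij_m.
(* Of the terms of the entry (i', j') only the one at k = min(i', j') is not
   yet known: the earlier ones agree by induction, the later ones vanish. *)
have T_eq (k i' j' : 'I_n) : (minn i' j' <= m)%N -> minn i' j' = k :> nat -> T f i' j' k = T g i' j' k.
  move=> ij'm ij'k.
  have := congr1 (fun B : 'M['I_E]_n => B i' j') eq_fg.
  rewrite /= !LDUE (bigD1 k)//= [in RHS](bigD1 k)//=.
  rewrite (eq_bigr (T g i' j')) => [/addIr//|l lk].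
  rewrite /T; have [l_lt|k_le] := ltnP l k.
    have lij : (l < i')%N && (l < j')%N by rewrite -leq_min ij'k.
    case/andP: lij => li lj; rewrite !mxE li lj.
    by rewrite !IH//=; lia.
  have {}k_le : (k < l)%N by rewrite ltn_neqAle k_le andbT eq_sym.
  have /orP[il|jl] : (i' < l)%N || (j' < l)%N by lia.
    by rewrite !lower_part0// !mul0r.
  by rewrite !upper_part0// !mulr0.
have fPk k : (f (k, k) < e k)%N && coprime (e k) (f (k, k)).
  by have := fP (k, k); rewrite /LDU_domain/= eqxx.
have gPk k : (g (k, k) < e k)%N && coprime (e k) (g (k, k)).
  by have := gP (k, k); rewrite /LDU_domain/= eqxx.
have diag_eq (k : 'I_n) : (k <= m)%N -> f (k, k) = g (k, k).
  move=> km; have := T_eq k k k; rewrite minnn => /(_ km erefl).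
  rewrite /T !mxE ltnn eqxx !mul1r !mulr1 => eq_c.
  have [/andP[fk _] /andP[gk _]] := (fPk k, gPk k).
  apply: (@c_cancel k 1) => //; first exact: coprimen1.
  by rewrite mulr1 ![_ * c k]mulrC.
have [ij|ji|/val_inj eq_ij] := ssrnat.ltngtP i j.
- have im : (i <= m)%N by rewrite -(minn_idPl (ltnW ij)).
  have := T_eq i i j; rewrite (minn_idPl (ltnW ij)) => /(_ im erefl).
  rewrite /T !mxE ltnn eqxx ij !mul1r diag_eq// => eq_c.
  have [/andP[_ copi]] := gPk i.
  have := fP (i, j); have := gP (i, j); rewrite /LDU_domain/= -val_eqE (ltn_eqF ij) ij !inE.
  move=> gi fi; apply: (c_cancel copi fi gi).
  by rewrite mulrC eq_c mulrC.
- have jm : (j <= m)%N by rewrite -(minn_idPr (ltnW ji)).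
  have := T_eq j i j; rewrite (minn_idPr (ltnW ji)) => /(_ jm erefl).
  rewrite /T !mxE ltnn eqxx ji !mulr1 diag_eq// => eq_c.
  have [/andP[_ copj]] := gPk j.
  have := fP (i, j); have := gP (i, j).
  rewrite /LDU_domain/= -val_eqE (gtn_eqF ji) ltnNge (ltnW ji)/= !inE.
  by move=> gj fj; apply: (c_cancel copj fj gj).
- by rewrite -eq_ij diag_eq//; move: ij_m; rewrite -eq_ij minnn.
Qed.

Let e_c0 (i l : 'I_n) : (l <= i)%N -> (e i)%:R * c l = 0.
Proof.
move=> li; apply/eqP; rewrite mulrC c_eq0 [nat_of_ord _](@val_Zp_nat E isT).
by rewrite dvdn_mod// e_chain.
Qed.

Lemma LDU_mull f i j : (e i)%:R * LDU f i j = 0.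
Proof.
rewrite LDUE mulr_sumr big1// => l _; have [li|il] := leqP l i.
  have -> : (e i)%:R * (lower_part f i l * (c l * f (l, l)) * upper_part f l j)
      = (e i)%:R * c l * (lower_part f i l * f (l, l) * upper_part f l j) by ring.
  by rewrite e_c0// mul0r.
by rewrite lower_part0// !mul0r mulr0.
Qed.

Lemma LDU_mulr f : LDU f *m diag_mx (\row_j (e j)%:R) = 0.
Proof.
apply/matrixP => i j; rewrite mul_mx_diag [LHS]mxE [X in _ * X]mxE [RHS]mxE.
rewrite LDUE mulr_suml big1// => l _; have [lj|jl] := leqP l j.
  have -> : lower_part f i l * (c l * f (l, l)) * upper_part f l j * (e j)%:R
      = (e j)%:R * c l * (lower_part f i l * f (l, l) * upper_part f l j) by ring.
  by rewrite e_c0// mul0r.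
by rewrite upper_part0// mulr0 mul0r.
Qed.

(** By the divisibility chain, e_min(i, j) is the gcd of e_i and e_j, so the
    domain reaches the product of gcds up to the loss e_i / phi(e_i) on the
    diagonal, which is at most d(e_i). *)
Lemma card_LDU_domain :
  (\prod_i \prod_j gcdn (e i) (e j) <= #|family LDU_domain| * \prod_i ndiv (e i))%N.
Proof.
have e_leE i : (e i <= E)%N by apply: dvdn_leq.
rewrite card_familyE -(pair_bigA _ (fun i j => #|LDU_domain (i, j)|))/=.
rewrite -big_split/=; apply: leq_prod => i _.
rewrite (bigD1 i)//= [X in (_ <= X * _)%N](bigD1 i)//= mulnAC; apply: leq_mul.
  rewrite gcdnn /LDU_domain/= eqxx (leq_trans (leq_totient_ndiv _))// leq_mul//.
  rewrite totient_count_coprime big_mkord (big_ord_widen _ (fun x => coprime (e i) x : nat) (e_leE i)).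
  rewrite -sum1_card big_mkcond [leqRHS]big_mkcond/=; apply: leq_sum => x _.
  by rewrite inE; case: (_ < _)%N => //=; case: coprime.
apply: leq_prod => j ji; rewrite /LDU_domain/= eq_sym (negPf ji).
rewrite card_ord_lt//; have [ij|le_ji] := ltnP i j.
  by rewrite (gcdn_idPl (e_chain (ltnW ij))).
by rewrite (gcdn_idPr (e_chain le_ji)).
Qed.

Let e_dvd_intr k (m : int) : (e k %| (m%:~R : 'I_E))%N = (e k %| absz m)%N.
Proof.
rewrite -c_eq0 -[c k]/(((E %/ e k)%N : int)%:~R) -intrM intr_ord_eq0 abszM.
by rewrite -/E -{1}(divnK (e_dvdE k)) dvdn_pmul2l// divn_gt0// dvdn_leq.
Qed.

(** Such z are multiples of E / gcd(e_i, h). *)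
Lemma card_annihilator i h :
  (#|[pred z : 'I_E | ((e i)%:R * z == 0)%R && (z * h%:R == 0)%R]| <= gcdn (e i) h)%N.
Proof.
set g := gcdn _ _; have gE : (g %| E)%N by apply: dvdn_trans (e_dvdE i); apply: dvdn_gcdl.
have g_gt0 : (0 < g)%N by rewrite gcdn_gt0 e_gt0.
have E_dvd (z : 'I_E) : ((e i)%:R * z == 0) && (z * h%:R == 0) -> (E %/ g %| z)%N.
  have := natr_Zp z; set k : nat := nat_of_ord z => <-.
  rewrite -!natrM !natr_ord_eq0 [(k * h)%N]mulnC -dvdn_gcd -muln_gcdl -/g -/E.
  by rewrite -{1}(divnK gE) [(_ %/ _ * _)%N]mulnC dvdn_pmul2l.
have q_gt0 : (0 < E %/ g)%N by rewrite divn_gt0// dvdn_leq.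
have lt_g (z : 'I_E) : (z %/ (E %/ g) < g)%N.
  by rewrite ltn_divLR// mulnC divnK.
rewrite -[leqRHS]card_ord.
apply: (@leq_card_in _ _ (fun z => Ordinal (lt_g z))) => z z' zP z'P /(congr1 val)/= eq_q.
have [dz dz'] := (E_dvd z zP, E_dvd z' z'P).
by apply: val_inj => /=; rewrite -(divnK dz) -(divnK dz') eq_q.
Qed.

(** A pair (A, f) gives the homomorphism Z^n -> Q with matrix LDU f K(A), whose
    kernel is exactly A Z^n by [LDU_kernel]. Hence it kills M = A B. In the
    coordinates of the Smith form of M, its entry (i, j) is annihilated by e_i
    and by h_j, which leaves gcd(e_i, h_j) values. Conversely the homomorphism
    determines its kernel, hence A as there is one A for each lattice, and then
    f by [LDU_inj]. *)
Lemma count_same_type (M Kh Uh : 'M[int]_n) (h : 'I_n -> nat)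
    (L : seq 'M[int]_n) (K : 'M[int]_n -> 'M[int]_n) :
  Kh \in unitmx -> Uh \in unitmx ->
  Kh *m M = diag_mx (\row_i (h i)%:Z) *m Uh ->
  uniq L -> {in L, forall A, exists B, A *m B = M} ->
  {in L, forall A, K A \in unitmx /\
    exists2 U, U \in unitmx & K A *m A = diag_mx (\row_i (e i)%:Z) *m U} ->
  {in L &, forall A A', (exists W, A' = A *m W) -> (exists W, A = A' *m W) -> A = A'} ->
  (size L * #|family LDU_domain| <= \prod_i \prod_j gcdn (e i) (h j))%N.
Proof.
move=> uKh uUh defM uniqL LM LK L_inj.
pose rho (X : 'M[int]_n) : 'M['I_E]_n := map_mx intr X.
have rhoM X Y : rho (X *m Y) = rho X *m rho Y by apply: map_mxM.
have rhoVl X : X \in unitmx -> rho (invmx X) *m rho X = 1%:M.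
  by move=> uX; rewrite -rhoM mulVmx// /rho map_mx1.
have rhoVr X : X \in unitmx -> rho X *m rho (invmx X) = 1%:M.
  by move=> uX; rewrite -rhoM mulmxV// /rho map_mx1.
have rho_diag (d : 'I_n -> nat) :
    rho (diag_mx (\row_i (d i)%:Z)) = diag_mx (\row_i (d i)%:R).
  by rewrite /rho map_diag_mx; congr diag_mx; apply/rowP => i; rewrite !mxE.
pose Psi A f := LDU f *m rho (K A).
have Psi_ann A f : A \in L -> Psi A f *m rho A = 0.
  move=> AL; have [_ [U _ KA]] := LK A AL.
  by rewrite /Psi -mulmxA -rhoM KA rhoM rho_diag mulmxA LDU_mulr mul0mx.
pose g (Af : 'M[int]_n * {ffun 'I_n * 'I_n -> 'I_E}) : {ffun 'I_n * 'I_n -> 'I_E} :=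
  [ffun ij => (Psi Af.1 Af.2 *m rho (invmx Kh)) ij.1 ij.2].
pose G (ij : 'I_n * 'I_n) : pred 'I_E :=
  [pred z : 'I_E | ((e ij.1)%:R * z == 0) && (z * (h ij.2)%:R == 0)].
pose X := [seq (A, f) | A <- L, f <- enum (family LDU_domain)].
(* Equal homomorphisms have equal kernels: K(A) A' has its i-th row divisible
   by e_i, hence A' Z^n is contained in A Z^n. *)
have Psi_inj A A' f f' : A \in L -> A' \in L -> f \in family LDU_domain ->
    Psi A f = Psi A' f' -> exists W, A' = A *m W.
  move=> AL A'L fD eq_Psi; have [uK [U uU KA]] := LK A AL.
  have := Psi_ann A' f' A'L; rewrite -eq_Psi /Psi -mulmxA -rhoM => ann.
  have dvd_row i j : (e i %| absz ((K A *m A') i j))%N.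
    have := @LDU_kernel f (col j (rho (K A *m A'))) fD _ i.
    by rewrite [col _ _]colE mulmxA ann mul0mx -colE mxE mxE e_dvd_intr; apply.
  pose Q : 'M[int]_n := \matrix_(i, j) ((K A *m A') i j %/ (e i)%:Z)%Z.
  have eQ : diag_mx (\row_i (e i)%:Z) *m Q = K A *m A'.
    apply/matrixP => i j; rewrite mul_diag_mx mxE [X in X * _]mxE [X in _ * X]mxE.
    by rewrite mulrC divzK// dvdzE dvd_row.
  exists (invmx U *m Q).
  have -> : A = invmx (K A) *m (diag_mx (\row_i (e i)%:Z) *m U) by rewrite -KA mulKmx.
  by rewrite -!mulmxA (mulKVmx uU) eQ mulKmx.
have uniq_gX : uniq (map g X).
  rewrite map_inj_in_uniq; last first.
    move=> _ _ /allpairsP[[A f] /= [AL + ->]] /allpairsP[[A' f'] /= [A'L + ->]].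
    rewrite !mem_enum => fD f'D /ffunP eq_g.
    have eq_Psi : Psi A f = Psi A' f'.
      have : Psi A f *m rho (invmx Kh) = Psi A' f' *m rho (invmx Kh).
        by apply/matrixP => i j; have := eq_g (i, j); rewrite !ffunE.
      move=> /(congr1 (mulmx^~ (rho Kh))).
      by rewrite /= -2!mulmxA rhoVl// 2!mulmx1.
    have eqA : A = A'.
      by apply: L_inj => //; [apply: Psi_inj eq_Psi | apply: Psi_inj (esym eq_Psi)].
    rewrite eqA in eq_Psi *; congr pair; have [uK _] := LK A' A'L.
    move: eq_Psi => /(congr1 (mulmx^~ (rho (invmx (K A'))))).
    by rewrite /Psi/= -2!mulmxA rhoVr// 2!mulmx1; apply: LDU_inj.
  by rewrite allpairs_uniq ?enum_uniq// => -[? ?] [? ?] _ _ [-> ->].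
have -> : (size L * #|family LDU_domain|)%N = size (map g X).
  by rewrite size_map size_allpairs cardE.
apply: (@leq_trans #|family G|).
  rewrite cardE; apply: uniq_leq_size => // _ /mapP[_ /allpairsP[[A f] /= [AL _ ->]] ->].
  rewrite mem_enum; apply/familyP => -[i j]; rewrite ffunE; apply/andP; split; apply/eqP.
    rewrite -mulmxA mxE mulr_sumr big1// => l _.
    by rewrite mulrA LDU_mull mul0r.
  have [B AB] := LM A AL.
  have : Psi A f *m rho (invmx Kh) *m diag_mx (\row_j (h j)%:R) = 0.
    have rhoME : rho M = rho (invmx Kh) *m diag_mx (\row_j (h j)%:R) *m rho Uh.
      by rewrite -rho_diag -!rhoM -mulmxA -defM mulKmx.
    have : Psi A f *m rho M *m rho (invmx Uh) = 0.
      by rewrite -AB rhoM mulmxA Psi_ann// !mul0mx.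
    by rewrite rhoME -mulmxA -[X in _ *m X]mulmxA rhoVr// mulmx1 mulmxA.
  by move=> /matrixP/(_ i j); rewrite mul_mx_diag mxE [X in _ * X]mxE [RHS]mxE.
rewrite card_familyE -(pair_bigA _ (fun i j => #|G (i, j)|))/=.
by apply: leq_prod => i _; apply: leq_prod => j _; apply: card_annihilator.
Qed.
End ElementaryDivisorCount.

Lemma card_divisor_functions n D : (0 < D)%N ->
  (#|family (fun _ : 'I_n => [pred d : 'I_D.+1 | (d %| D)%N])| <= ndiv D ^ n)%N.
Proof.
move=> D_gt0; rewrite card_familyE prod_nat_const card_ord leqXr// cardE.
rewrite /ndiv -(size_map val); apply: uniq_leq_size.
  by rewrite (map_inj_uniq val_inj) enum_uniq.
by move=> _ /mapP[d + ->]; rewrite mem_enum inE -dvdn_divisors.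
Qed.

(** The elementary divisors of A are n divisors of D, so there are at most
    d(D)^n types, and it is enough to count the lattices of one type e. By
    [count_same_type] and [card_LDU_domain] these are at most
    prod_ij gcd(e_i, h_j) / prod_ij gcd(e_i, e_j) up to d(D)^n, and the quotient
    is bounded by D^(floor(n^2/4) / n) by [prod_gcdn_le]. *)
Lemma count_divisor_classes n (M : 'M[int]_n) (L : seq 'M[int]_n) :
  (0 < n)%N -> \det M != 0 -> uniq L -> {in L, forall A, exists B, A *m B = M} ->
  {in L &, forall A A', (exists W, A' = A *m W) -> (exists W, A = A' *m W) -> A = A'} ->
  (size L ^ n <= ndiv (absz (\det M)) ^ (2 * (n * n)) * absz (\det M) ^ (n ^ 2 %/ 4))%N.
Proof.
move=> n_gt0 detM uniqL LM L_inj; set D := absz (\det M).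
have D_gt0 : (0 < D)%N by rewrite absz_gt0.
have [Kh [Uh [h [uKh uUh defM _ prod_h]]]] := int_Smith_square detM.
have h_gt0 i : (0 < h i)%N.
  rewrite lt0n; apply: contraTneq D_gt0 => hi0.
  by rewrite /D -prod_h (bigD1 i)//= hi0 mul0n.
pose smith_data A (d : 'M[int]_n * ('I_n -> nat)) := A \in L ->
  [/\ d.1 \in unitmx /\
     exists2 U, U \in unitmx & d.1 *m A = diag_mx (\row_i (d.2 i)%:Z) *m U,
     (forall i j : 'I_n, (i <= j)%N -> (d.2 i %| d.2 j)%N) &
     (forall i, d.2 i %| D)%N].
have [data dataP] : {data & forall A, smith_data A (data A)}.
  apply: choice => A; have [AL|AnL] := boolP (A \in L); last first.
    by exists (0, fun=> 0%N); rewrite /smith_data (negPf AnL).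
  have [B AB] := LM A AL.
  have detA : \det A != 0 by apply: contraNneq detM => detA; rewrite -AB det_mulmx detA mul0r.
  have [K [U [e [uK uU KA e_chain prod_e]]]] := int_Smith_square detA.
  exists (K, e) => _; split=> //=; first by split=> //; exists U.
  move=> i; apply: (@dvdn_trans (absz (\det A))); first by rewrite -prod_e (bigD1 i)//= dvdn_mulr.
  by rewrite /D -AB det_mulmx abszM dvdn_mulr.
pose ty A : {ffun 'I_n -> 'I_D.+1} := [ffun i => inord ((data A).2 i)].
have tyE A i : A \in L -> (data A).2 i = ty A i :> nat.
  by move=> AL; rewrite ffunE inordK// ltnS dvdn_leq//; case: (dataP A AL).
pose types := enum (family (fun _ : 'I_n => [pred d : 'I_D.+1 | (d %| D)%N])).
have [->|L_neq0] := eqVneq L [::]; first by rewrite exp0n.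
have [|ev ev_in] := @pigeonhole _ _ L ty types _ L_neq0.
  move=> A AL; rewrite mem_enum; apply/familyP => i; rewrite inE -tyE//.
  by case: (dataP A AL).
set Le := [seq A <- L | ty A == ev] => size_L.
pose e i : nat := ev i.
have memLe A : A \in Le -> A \in L /\ forall i, (data A).2 i = e i.
  rewrite mem_filter => /andP[/eqP tyA AL]; by split=> // i; rewrite /e -tyA tyE.
have e_dvdD i : (e i %| D)%N.
  by move: ev_in; rewrite mem_enum => /familyP/(_ i); rewrite inE.
have e_gt0 i : (0 < e i)%N := dvdn_gt0 D_gt0 (e_dvdD i).
have bound_Le : (size Le ^ n <= ndiv D ^ (n * n) * D ^ (n ^ 2 %/ 4))%N.
  have [->|Le_neq0] := eqVneq Le [::]; first by rewrite exp0n.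
  have e_chain (i j : 'I_n) : (i <= j)%N -> (e i %| e j)%N.
    have /hasP[A /memLe[AL eE] _] : has predT Le by rewrite has_predT lt0n size_eq0.
    move=> ij; by rewrite -!eE; case: (dataP A AL) => _ + _; apply.
  (* Any common multiple E >= 2 of the e_i serves as modulus; D itself may be 1. *)
  have [F FE] : exists F, F.+2 = (2 * D)%N by exists (2 * D - 2)%N; lia.
  have e_dvdE i : (e i %| F.+2)%N by rewrite FE dvdn_mull.
  have count := @count_same_type F n e e_dvdE e_chain M Kh Uh h Le (fun A => (data A).1).
  have {}count : (size Le * #|family (@LDU_domain F n e)| <= \prod_i \prod_j gcdn (e i) (h j))%N.
    apply: count => //; first exact: filter_uniq.
    - by move=> A /memLe[AL _]; apply: LM.
    - move=> A /memLe[AL eE]; have [[uK [U uU KA]] _ _] := dataP A AL; split=> //.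
      exists U => //; rewrite KA; congr (diag_mx _ *m _).
      by apply/rowP => i; rewrite !mxE eE.
    - by move=> A A' /memLe[AL _] /memLe[A'L _]; apply: L_inj.
  have lb := card_LDU_domain e_dvdE e_chain.
  set G1 := (\prod_i \prod_j gcdn (e i) (e j))%N in lb.
  set G2 := (\prod_i \prod_j gcdn (e i) (h j))%N in count.
  have G1_gt0 : (0 < G1)%N.
    by apply: prodn_gt0 => i; apply: prodn_gt0 => j; rewrite gcdn_gt0 e_gt0.
  have prod_ndiv : (\prod_i ndiv (e i) <= ndiv D ^ n)%N.
    rewrite -[X in (_ ^ X)%N]card_ord -prod_nat_const.
    by apply: leq_prod => i _; apply: leq_ndiv.
  have size_G : (size Le * G1 <= G2 * ndiv D ^ n)%N.
    apply: leq_trans (leq_mul count prod_ndiv).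
    by rewrite -mulnA leq_mul2l lb orbT.
  have key : (G2 ^ n <= G1 ^ n * D ^ (n ^ 2 %/ 4))%N.
    by have := prod_gcdn_le e_gt0 h_gt0; rewrite prod_h.
  rewrite -(@leq_pmul2l (G1 ^ n)%N) ?expn_gt0 ?G1_gt0// -expnMn [(G1 * _)%N]mulnC.
  apply: (leq_trans (leqXr n size_G)); rewrite expnMn -expnM mulnC [leqRHS]mulnCA.
  by rewrite leq_mul2l key orbT.
apply: (leq_trans (leqXr n size_L)); rewrite expnMn.
apply: (leq_trans (leq_mul (leqXr n _) bound_Le)).
  by rewrite -cardE; apply: card_divisor_functions.
by rewrite mulnA -expnM -expnD mul2n addnn.
Qed.

(** * Bounded matrices and Gaussian elimination *)

Definition mx_le (F : numDomainType) m n (c : F) (A : 'M[F]_(m, n)) :=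
  forall i j, `|A i j| <= c.

Section EntryBounds.
Variable F : realFieldType.

Lemma mx_le_mul m n p (a b : F) (A : 'M[F]_(m, n)) (B : 'M[F]_(n, p)) :
  mx_le a A -> mx_le b B -> mx_le (n%:R * (a * b)) (A *m B).
Proof.
move=> Aa Bb i j; rewrite mxE (le_trans (ler_norm_sum _ _ _))//.
rewrite -[X in X%:R]card_ord -sum1_card natr_sum mulr_suml ler_sum// => k _.
by rewrite mul1r normrM ler_pM.
Qed.

Lemma mx_le_trans m n (a b : F) (A : 'M[F]_(m, n)) : a <= b -> mx_le a A -> mx_le b A.
Proof. by move=> ab Aa i j; apply: le_trans ab. Qed.

Lemma mx_le_block m1 m2 n1 n2 (c : F) (A : 'M[F]_(m1, n1)) (B : 'M[F]_(m1, n2))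
    (C : 'M[F]_(m2, n1)) (D : 'M[F]_(m2, n2)) :
  mx_le c A -> mx_le c B -> mx_le c C -> mx_le c D -> mx_le c (block_mx A B C D).
Proof.
move=> Ac Bc Cc Dc i j; rewrite !mxE.
by case: fintype.split => ?; rewrite !mxE; case: fintype.split => ?.
Qed.

Lemma mx_le_scalar1 (c a : F) : `|a| <= c -> mx_le c (a%:M : 'M[F]_1).
Proof. by move=> ac i j; rewrite !mxE !ord1 eqxx. Qed.

Lemma mx_le_0 m n (c : F) : 0 <= c -> mx_le c (0 : 'M[F]_(m, n)).
Proof. by move=> c0 i j; rewrite mxE normr0. Qed.

Lemma mx_le_1 n (c : F) : 1 <= c -> mx_le c (1%:M : 'M[F]_n).
Proof.
by move=> c1 i j; rewrite mxE; case: eqP; rewrite ?normr1 ?normr0// (le_trans ler01).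
Qed.

Lemma mx_le_perm n (c : F) (s : 'S_n) : 1 <= c -> mx_le c (perm_mx s : 'M[F]_n).
Proof.
by move=> c1 i j; rewrite !mxE; case: eqP; rewrite ?normr1 ?normr0// (le_trans ler01).
Qed.

Lemma pivot_exists n (A : 'M[F]_n.+1) : \det A != 0 ->
  exists i j, A i j != 0 /\ mx_le `|A i j| A.
Proof.
move=> detA.
have [[i j] _ max_ij] := @Order.TotalTheory.arg_maxP _ _ _ (ord0, ord0) predT
  (fun ij : 'I_n.+1 * 'I_n.+1 => `|A ij.1 ij.2|) isT.
exists i, j; split; last by move=> i' j'; apply: (max_ij (i', j')).
apply: contraNneq detA => Aij0; rewrite (_ : A = 0) ?det0//.
apply/matrixP => i' j'; apply/eqP; rewrite mxE -normr_le0.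
by rewrite (le_trans (max_ij (i', j') isT))//= Aij0 normr0.
Qed.

Lemma schur_factor n (a : F) (y : 'rV[F]_n) (x : 'cV[F]_n) (A' : 'M[F]_n) : a != 0 ->
  block_mx (a%:M : 'M[F]_1) y x A' =
  block_mx 1%:M 0 (a^-1 *: x) 1%:M *m block_mx a%:M 0 0 (A' - a^-1 *: (x *m y)) *m
  block_mx 1%:M (a^-1 *: y) 0 1%:M.
Proof.
move=> a0; rewrite !mulmx_block !(mul0mx, mulmx0, mul1mx, mulmx1, addr0, add0r).
rewrite !mul_scalar_mx !mul_mx_scalar !scalerA !mulfV// !scale1r.
by rewrite -scalemxAr addrC subrK.
Qed.

Lemma det_schur n (a : F) (y : 'rV[F]_n) (x : 'cV[F]_n) (A' : 'M[F]_n) : a != 0 ->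
  \det (block_mx (a%:M : 'M[F]_1) y x A') = a * \det (A' - a^-1 *: (x *m y)).
Proof.
move=> a0; rewrite schur_factor// !det_mulmx !det_lblock det_ublock !det1 !mul1r.
by rewrite det_scalar1 mulr1.
Qed.

(** Only bounds for the blocks matter in the eliminations below; so their entries
    are merely located, in A or in the pivot row. *)
Lemma swap_block n (A : 'M[F]_n.+1) i0 j0 :
  exists (y : 'rV[F]_n) (x : 'cV[F]_n) (A' : 'M[F]_n),
    [/\ tperm_mx ord0 i0 *m A *m tperm_mx ord0 j0 =
          block_mx ((A i0 j0)%:M : 'M[F]_1) y x A' :> 'M[F]_(1 + n),
        forall k l, exists j, y k l = A i0 j,
        forall k l, exists i j, x k l = A i j &
        forall k l, exists i j, A' k l = A i j].
Proof.
rewrite -xrowE -xcolE; set B : 'M[F]_(1 + n) := xcol _ _ _.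
have BE i j : B i j = A (tperm ord0 i0 i) (tperm ord0 j0 j) by rewrite !mxE.
have lshift0 : lshift n (ord0 : 'I_1) = ord0 :> 'I_n.+1 by apply: val_inj.
exists (ursubmx B), (dlsubmx B), (drsubmx B); split.
- rewrite -{1}[B]submxK; congr block_mx; rewrite [LHS]mx11_scalar; congr (_%:M).
  by rewrite !mxE -!BE BE lshift0 !tpermL.
- move=> k l; rewrite !mxE -BE BE [k]ord1 lshift0 tpermL.
  by eexists.
- by move=> k l; rewrite !mxE; do 2 eexists.
- by move=> k l; rewrite !mxE; do 2 eexists.
Qed.

(** Row 0 is the pivot row. With its largest entry as pivot, the multipliers
    that clear the rest of the row have absolute value at most 1; so V is
    bounded independently of M. *)
Lemma column_reduction n : exists2 C : F, 1 <= C &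
  forall M : 'M[F]_n, \det M != 0 ->
  exists V : 'M[F]_n, [/\ mx_le C V, `|\det V| = 1 & is_trig_mx (M *m V)].
Proof.
elim: n => [|n [C C1 IH]].
  exists 1 => // M _; exists 1%:M; split; first exact: mx_le_1.
    by rewrite det1 normr1.
  by apply/is_trig_mxP => -[].
have C0 : 0 <= C := le_trans ler01 C1.
exists (n.+1%:R * (n.+1%:R * (1 * 1) * C)).
  rewrite !mulr1 mulrA -natrM; apply: (le_trans C1).
  by apply: ler_peMl; rewrite ?ler1n.
move=> M detM.
have [j0 Mj0] : exists j0, M ord0 j0 != 0.
  have [/existsP//|/existsPn row0] := boolP [exists j, M ord0 j != 0].
  case/negP: detM; rewrite (expand_det_row _ ord0) big1// => j _.
  by have /negPn/eqP-> := row0 j; rewrite mul0r.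
have [j _ max_j] := @Order.TotalTheory.arg_maxP _ _ _ j0 predT (fun j => `|M ord0 j|) isT.
have Mj : M ord0 j != 0.
  by apply: contraNneq Mj0 => Mj; rewrite -normr_le0 (le_trans (max_j j0 isT))//= Mj normr0.
have [y [x [M' [MQ yE _ _]]]] := swap_block M ord0 j.
set a := M ord0 j in MQ Mj.
set Q := tperm_mx ord0 j in MQ.
have detQ : `|\det Q| = 1 by rewrite det_perm normrX normrN1 expr1n.
have {}MQ : M *m Q = block_mx (a%:M : 'M[F]_1) y x M' :> 'M[F]_(1 + n).
  by rewrite -MQ /tperm_mx tperm1 perm_mx1 mul1mx.
have ay_le : mx_le 1 (a^-1 *: y).
  move=> k l; rewrite mxE; have [l' ->] := yE k l.
  by rewrite normrM normfV mulrC ler_pdivrMr ?normr_gt0// mul1r; apply: max_j.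
pose S := M' - a^-1 *: (x *m y).
have detS : \det S != 0.
  have : \det (M *m Q) != 0 by rewrite det_mulmx mulf_neq0// -normr_eq0 detQ oner_eq0.
  by rewrite MQ det_schur// mulf_eq0 => /norP[].
have [V [V_le detV trigV]] := IH S detS.
pose W : 'M[F]_(1 + n) := block_mx (1%:M : 'M[F]_1) (- (a^-1 *: y)) 0 1%:M.
pose V1 : 'M[F]_(1 + n) := block_mx (1%:M : 'M[F]_1) 0 0 V.
exists (Q *m W *m V1); split.
- apply: mx_le_mul; first apply: mx_le_mul; first exact: mx_le_perm.
    apply: (@mx_le_block 1 n 1 n); [exact: mx_le_1| |exact: mx_le_0|exact: mx_le_1].
    by move=> k l; rewrite mxE normrN.
  by apply: (@mx_le_block 1 n 1 n); [exact: mx_le_1|exact: mx_le_0|exact: mx_le_0|].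
- rewrite !det_mulmx !normrM detQ (det_ublock (1%:M : 'M[F]_1)) (det_ublock (1%:M : 'M[F]_1)).
  by rewrite !det1 !mul1r normr1 mul1r.
- have -> : M *m (Q *m W *m V1) = block_mx (a%:M : 'M[F]_1) 0 x (S *m V) :> 'M[F]_(1 + n).
    transitivity (@mulmx F (1 + n) (1 + n) (1 + n) (@mulmx F (1 + n) (1 + n) (1 + n) (M *m Q) W) V1).
      by rewrite !mulmxA.
    rewrite MQ /W /V1 !mulmx_block !(mul1mx, mulmx1, mul0mx, mulmx0, addr0, add0r).
    rewrite mulmxN mul_scalar_mx scalerA mulfV// scale1r addNr mulmxN -scalemxAr.
    by rewrite [- _ + _]addrC mul0mx.
  have : @is_trig_mx F (1 + n) (1 + n) (block_mx a%:M 0 x (S *m V)).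
    by rewrite is_trig_block_mx// eqxx scalar_mx_is_trig.
  by [].
Qed.
End EntryBounds.

Section PivotedReduction.
Variable F : archiRealFieldType.

Lemma dyadic_below (z a : F) : 0 < a -> a <= z ->
  exists p, z / 2 ^+ p <= a /\ a < 2 * (z / 2 ^+ p).
Proof.
move=> a_gt0 az; have z_gt0 := lt_le_trans a_gt0 az.
have two_gt0 p : 0 < 2 ^+ p :> F by rewrite exprn_gt0.
have ex : exists p, z / 2 ^+ p <= a.
  have [m zam] : exists m, z / a < m%:R.
    by exists (Num.bound (z / a)); apply: archi_boundP; rewrite divr_ge0 ?ltW.
  exists m; rewrite ler_pdivrMr// mulrC -ler_pdivrMr//.
  by rewrite (le_trans (ltW zam))// -natrX ler_nat ltnW// ltn_expl.
case: (ex_minnP ex) => p zp min_p; exists p; split=> //.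
case: p zp min_p => [|p] zp min_p.
  by rewrite expr0 divr1 (le_lt_trans az)// ltr_pMl// ltr1n.
rewrite ltNge; apply/negP => le_a.
have /min_p : z / 2 ^+ p <= a.
  by move: le_a; rewrite exprS invfM mulrCA [2 * _]mulrA mulfV ?pnatr_eq0// mul1r.
by rewrite ltnn.
Qed.

(** Elimination with complete pivoting gives P A Q = L diag(a) U, where P and Q
    are permutation matrices and L and U are unipotent and bounded. Replacing the
    pivots a_i by dyadic numbers b_i changes the right factor by a bounded
    amount. The matrix diag(b)^-1 L diag(b) is still unipotent, with entries of
    size O(b_j / b_i), and multiplication by a suitable integer unipotent
    matrix G brings it into a bounded set.

    Before rounding, the entries of a Schur complement are at most twice the
    pivot, and the pivot is at most twice its dyadic approximation b0, so the
    induction hypothesis is used with 4 b0 in the place of z. The factor 4^n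
    leaves room for these losses, so that the exponents p are nonnegative. *)
Lemma pivoted_reduction n : exists2 C : F, 1 <= C &
  forall (A : 'M[F]_n) z, \det A != 0 -> 0 < z -> mx_le z A ->
  exists (s : 'S_n) (p : 'I_n -> nat) (G : 'M[int]_n) (k k' : 'M[F]_n),
    let b i := 4 ^+ n * z / 2 ^+ p i in
    [/\ [/\ is_trig_mx G, forall i, G i i = 1 &
             forall i j, `|(G i j)%:~R| * b i <= C * b j],
        map_mx intr G *m diag_mx (\row_i (b i)^-1) *m perm_mx s *m A = k,
        k *m k' = 1%:M, mx_le C k & mx_le C k'].
Proof.
elim: n => [|n [C C1 IH]].
  exists 1 => // A z _ _ _; exists 1%g, (fun=> 0%N), 1%:M, 1%:M, 1%:M.
  split; [split| | | |]; try by case.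
  - by apply/is_trig_mxP => -[].
  - by apply/matrixP => -[].
  - by apply/matrixP => -[].
have C0 : 0 <= C := le_trans ler01 C1.
pose Ck := n.+1%:R * (n.+1%:R * ((2 + C) * (2 + C)) * (2 + C)).
pose Cg := n%:R * C + 4 ^+ n.+1 + C.
have Cg_ge : C <= Cg by rewrite lerDr addr_ge0 ?mulr_ge0 ?exprn_ge0.
have Ck_ge0 : 0 <= Ck by rewrite !mulr_ge0 ?addr_ge0.
exists (n.+1%:R * Ck + Cg).
  by rewrite (le_trans C1)// (le_trans Cg_ge)// lerDr mulr_ge0.
move=> A z detA z_gt0 A_le.
have [i0 [j0 [a0 A_le_a]]] := pivot_exists detA.
have [y [x [A' [A1E yE xE A'E]]]] := swap_block A i0 j0.
set a := A i0 j0 in a0 A_le_a A1E.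
have na_gt0 : 0 < `|a| by rewrite normr_gt0.
have [p0 [b0_le lt_b0]] := dyadic_below na_gt0 (A_le i0 j0).
set b0 := z / 2 ^+ p0 in b0_le lt_b0.
have b0_gt0 : 0 < b0 by rewrite divr_gt0// exprn_gt0.
have b0E : b0 = z / 2 ^+ p0 by [].
clearbody b0.
pose S := A' - a^-1 *: (x *m y).
have detS : \det S != 0.
  have : \det (tperm_mx ord0 i0 *m A *m tperm_mx ord0 j0) != 0.
    by rewrite !det_mulmx !det_perm !mulf_neq0// signr_eq0.
  by rewrite A1E det_schur// mulf_eq0 => /norP[].
have x_le : mx_le `|a| x by move=> k l; have [i [j ->]] := xE k l; apply: A_le_a.
have y_le : mx_le `|a| y by move=> k l; have [j ->] := yE k l; apply: A_le_a.
have S_le : mx_le (4 * b0) S.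
  move=> i j; rewrite !mxE big_ord1; have [i' [j' ->]] := A'E i j.
  have xy_le : `|a^-1 * (x i 0 * y 0 j)| <= `|a|.
    rewrite !normrM normfV ler_pdivrMl//.
    by apply: ler_pM.
  have := ler_normB (A i' j') (a^-1 * (x i 0 * y 0 j)).
  have := A_le_a i' j'; lra.
have [s' [p' [G' [k2 [k2' /= [[trigG' diagG' G'_le] defk2 k2K k2_le k2'_le]]]]]] :=
  IH S (4 * b0) detS (mulr_gt0 (ltr0n _ 4) b0_gt0) S_le.
have [b' b'E] : exists b', forall i, b' i = 4 ^+ n * (4 * b0) / 2 ^+ p' i by eexists.
have b'_gt0 i : 0 < b' i by rewrite b'E !mulr_gt0 ?invr_gt0 ?exprn_gt0 ?ltr0n.
have {}G'_le i j : `|(G' i j)%:~R| * b' i <= C * b' j by rewrite !b'E.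
have {}defk2 : map_mx intr G' *m diag_mx (\row_i (b' i)^-1) *m perm_mx s' *m S = k2.
  by rewrite -defk2; congr (_ *m diag_mx _ *m _ *m _); apply/rowP => i; rewrite !mxE b'E.
pose D' := diag_mx (\row_i (b' i)^-1).
(* The column below the pivot after the reduction of the Schur complement.
   Adding integer multiples g of the pivot row, which is scaled by 1 / b0,
   makes it the bounded column f. *)
pose v := map_mx intr G' *m D' *m perm_mx s' *m x.
pose g : 'cV[int]_n := \col_i - Num.floor (v i ord0 * b0 / a).
pose f : 'cV[F]_n := v + (a / b0) *: map_mx intr g.
have t_itv i : let t := v i ord0 * b0 / a in
    0 <= t - (Num.floor t)%:~R <= 1.
  move=> t; have /andP[t1 t2] := floor_itv t.
  by rewrite subr_ge0 t1 lerBlDl ltW// -[1]/(1%:~R) -intrD.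
have f_le : mx_le 2 f.
  move=> i l; rewrite [l]ord1 mxE [X in _ + X]mxE [X in _ * X]mxE [g _ _]mxE.
  set t := v i ord0 * b0 / a; have /andP[t_ge0 t_le1] := t_itv i.
  have -> : v i ord0 + a / b0 * (- Num.floor t)%:~R = (t - (Num.floor t)%:~R) * (a / b0).
    rewrite mulrNz mulrN mulrBl [_%:~R * _]mulrC; congr (_ - _).
    by rewrite /t; field; rewrite a0 gt_eqF.
  rewrite normrM ger0_norm// -[leRHS]mul1r ler_pM//.
  by rewrite normrM normfV (gtr0_norm b0_gt0) ler_pdivrMr// ltW.
have v_le i : `|v i ord0| * b' i <= n%:R * C * `|a|.
  rewrite /v -mulmxA mxE -[X in _ * X](gtr0_norm (b'_gt0 i)) -normrM mulr_suml.
  rewrite (le_trans (ler_norm_sum _ _ _))// -mulrA.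
  rewrite -[X in X%:R * _]card_ord -sum1_card natr_sum [leRHS]mulr_suml ler_sum// => l _.
  rewrite mul1r mul_mx_diag -row_permE !mxE !normrM normfV !(gtr0_norm (b'_gt0 _)).
  have -> : `|(G' i l)%:~R| / b' l * `|x (s' l) ord0| * b' i =
    `|(G' i l)%:~R| * b' i / b' l * `|x (s' l) ord0| by ring.
  apply: ler_pM => //; first by rewrite divr_ge0 ?mulr_ge0// ltW.
  by rewrite ler_pdivrMr// G'_le.
have g_le i l : `|(g i l)%:~R| * b' i <= Cg * b0.
  rewrite [l]ord1 [g _ _]mxE mulrNz normrN; set t := v i ord0 * b0 / a.
  have b'_le : b' i <= 4 ^+ n.+1 * b0.
    rewrite b'E mulrA -exprSr ler_pdivrMr ?exprn_gt0// ler_peMr//.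
      by rewrite mulr_ge0 ?exprn_ge0// ltW.
    by rewrite exprn_ege1// ler1n.
  have t_le : `|t| * b' i <= n%:R * C * b0.
    rewrite !normrM normfV (gtr0_norm b0_gt0).
    have -> : `|v i ord0| * b0 / `|a| * b' i = `|v i ord0| * b' i * (b0 / `|a|) by ring.
    apply: le_trans (ler_wpM2r _ (v_le i)) _; first by rewrite divr_ge0// ltW.
    by rewrite -[leLHS]mulrA [(`|a| * _)]mulrC divfK// gt_eqF.
  have /andP[t0 t1] := t_itv i.
  have floor_le1 : `|(Num.floor t)%:~R : F| <= `|t| + 1.
    rewrite -[X in `|X|](subKr t) (le_trans (ler_normB _ _))// lerD2l.
    by rewrite ger0_norm.
  rewrite (le_trans (ler_wpM2r (ltW (b'_gt0 i)) floor_le1))// mulrDl mul1r.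
  rewrite /Cg !mulrDl -addrA lerD// (le_trans b'_le)// lerDl mulr_ge0//.
  exact: ltW.
(* The shift by 2 (n + 1) compensates the factor 4^(n + 1) in the first scale,
   which has to be b0. *)
pose p (i : 'I_(1 + n)) :=
  match fintype.split i with inl _ => (p0 + 2 * n.+1)%N | inr l => (p0 + p' l)%N end.
pose G : 'M[int]_(1 + n) := block_mx 1%:M 0 g G'.
pose T : 'M[F]_(1 + n) := tperm_mx (ord0 : 'I_n.+1) j0.
pose kL : 'M[F]_(1 + n) := block_mx 1%:M 0 ((b0 / a) *: f) 1%:M.
pose kD : 'M[F]_(1 + n) := block_mx (a / b0)%:M 0 0 k2.
pose kU : 'M[F]_(1 + n) := block_mx 1%:M (a^-1 *: y) 0 1%:M.
pose kL' : 'M[F]_(1 + n) := block_mx 1%:M 0 (- ((b0 / a) *: f)) 1%:M.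
pose kD' : 'M[F]_(1 + n) := block_mx (b0 / a)%:M 0 0 k2'.
pose kU' : 'M[F]_(1 + n) := block_mx 1%:M (- (a^-1 *: y)) 0 1%:M.
have k_le (X Y Z : 'M[F]_(1 + n)) : mx_le (2 + C) X -> mx_le (2 + C) Y -> mx_le (2 + C) Z ->
    mx_le Ck (X *m Y *m Z).
  by move=> X_le Y_le Z_le; apply: mx_le_mul => //; apply: mx_le_mul.
have C2_ge1 : 1 <= 2 + C by rewrite (le_trans C1)// lerDr.
have ab_le : `|a / b0| <= 2.
  by rewrite normrM normfV (gtr0_norm b0_gt0) ler_pdivrMr// ltW.
have ba_le : `|b0 / a| <= 1.
  by rewrite normrM normfV (gtr0_norm b0_gt0) ler_pdivrMr// mul1r.
have fa_le : mx_le (2 + C) ((b0 / a) *: f).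
  move=> i l; rewrite mxE normrM (le_trans (ler_pM _ _ ba_le (f_le i l)))//.
  by rewrite mul1r lerDl.
have ya_le : mx_le (2 + C) (a^-1 *: y).
  move=> i l; rewrite mxE normrM normfV ler_pdivrMl// (le_trans (y_le i l))//.
  by rewrite ler_peMr.
have leN (m1 m2 : nat) (c : F) (X : 'M[F]_(m1, m2)) : mx_le c X -> mx_le c (- X).
  by move=> X_le i j; rewrite mxE normrN.
have C2_ge0 : 0 <= 2 + C by rewrite (le_trans ler01).
have le_2C c : c <= 2 -> c <= 2 + C by move=> /le_trans; apply; rewrite lerDl.
pose b i := 4 ^+ n.+1 * z / 2 ^+ p i.
have b_l i : b (lshift n i) = b0.
  rewrite /b /p (unsplitK (inl i)) b0E exprD exprM -[2 ^+ 2]natrX.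
  have : 4%:R ^+ n.+1 != 0 :> F by rewrite expf_neq0 ?pnatr_eq0.
  have : 2%:R ^+ p0 != 0 :> F by rewrite expf_neq0 ?pnatr_eq0.
  by move: (2%:R ^+ p0) (4%:R ^+ n.+1) => u w u0 w0; field; rewrite u0 w0.
have b_r i : b (rshift 1 i) = b' i.
  rewrite /b /p (unsplitK (inr i)) b'E b0E exprD invfM exprSr.
  by rewrite -!mulrA; do 2 congr (_ * _); rewrite mulrCA.
set Ctot := n.+1%:R * Ck + Cg.
have Cg_tot : Cg <= Ctot by rewrite lerDr mulr_ge0.
have C_tot : C <= Ctot by apply: le_trans Cg_tot.
have trigG : @is_trig_mx _ (1 + n) (1 + n) G.
  by rewrite is_trig_block_mx// eqxx trigG' scalar_mx_is_trig.
have diagG i : G i i = 1.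
  by case: (split_ordP i) => l ->; rewrite ?block_mxEul ?block_mxEdr// [l]ord1 mxE.
have G_le i j : `|(G i j)%:~R| * b i <= Ctot * b j.
  case: (split_ordP i) => k ->; case: (split_ordP j) => l ->;
    rewrite ?block_mxEul ?block_mxEur ?block_mxEdl ?block_mxEdr ?b_l ?b_r.
  - rewrite [k]ord1 [l]ord1 mxE eqxx normr1 ler_pM2r//; exact: le_trans C_tot.
  - by rewrite mxE mulr0z normr0 mul0r mulr_ge0 ?(le_trans C0 C_tot)// ltW.
  - by apply: le_trans (g_le _ _) _; rewrite ler_pM2r.
  - by apply: le_trans (G'_le _ _) _; rewrite ler_pM2r.
pose Db : 'M[F]_(1 + n) := diag_mx (\row_i (b i)^-1).
have DbE : Db = block_mx (b0^-1)%:M 0 0 D'.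
  rewrite /Db (_ : \row_i _ = row_mx (const_mx b0^-1) (\row_i (b' i)^-1)).
    by rewrite diag_mx_row diag_const_mx.
  apply/rowP => i; rewrite mxE; case: (split_ordP i) => k ->.
    by rewrite row_mxEl b_l mxE.
  by rewrite row_mxEr b_r mxE.
have TT : T *m T = 1%:M by rewrite -perm_mxM tperm2 perm_mx1.
pose P : 'M[F]_(1 + n) := perm_mx (lift0_perm s' * tperm (ord0 : 'I_n.+1) i0)%g.
have PA : P *m (A : 'M[F]_(1 + n)) = lift0_mx (perm_mx s') *m block_mx a%:M y x A' *m T.
  by rewrite /P perm_mxM lift0_mx_perm -A1E !mulmxA -[RHS]mulmxA TT mulmx1.
have factk : map_mx intr G *m Db *m P *m (A : 'M[F]_(1 + n)) = kL *m kD *m kU *m T.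
  rewrite -mulmxA PA !mulmxA; congr (_ *m T).
  rewrite schur_factor// -/S !mulmxA; congr (_ *m kU).
  rewrite DbE /G map_block_mx map_mx1 map_mx0 /lift0_mx /kL /kD !mulmx_block.
  rewrite !(mul1mx, mulmx1, mul0mx, mulmx0, addr0, add0r) -/D'.
  rewrite -!scalar_mxM mulrC mulmxDl defk2.
  congr (block_mx _ _ _ _).
  rewrite -scalemxAr -/v !mul_mx_scalar !scalerA mulfV// scale1r.
  have -> : a / b0 * (b0 / a) = 1 by field; rewrite a0 gt_eqF.
  by rewrite scale1r /f addrC.
have kk' : kL *m kD *m kU *m T *m (T *m (kU' *m kD' *m kL')) = 1%:M.
  rewrite !mulmxA -[_ *m T *m T]mulmxA TT mulmx1 -[_ *m kU *m kU']mulmxA.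
  have -> : kU *m kU' = 1%:M.
    rewrite mulmx_block !(mul1mx, mulmx1, mul0mx, mulmx0, addr0, add0r) addNr.
    by rewrite -scalar_mx_block.
  rewrite mulmx1 -[_ *m kD *m kD']mulmxA.
  have -> : kD *m kD' = 1%:M.
    rewrite mulmx_block !(mul1mx, mulmx1, mul0mx, mulmx0, addr0, add0r) k2K -scalar_mxM.
    by rewrite mulrA divfK ?gt_eqF// mulfV// -scalar_mx_block.
  rewrite mulmx1 mulmx_block !(mul1mx, mulmx1, mul0mx, mulmx0, addr0, add0r) subrr.
  by rewrite -scalar_mx_block.
exists (lift0_perm s' * tperm ord0 i0)%g, p, G, (kL *m kD *m kU *m T), (T *m (kU' *m kD' *m kL')).
split; [by split|exact: factk|exact: kk'| |].
- move=> i j; apply: (@le_trans _ _ (n.+1%:R * (Ck * 1))); last first.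
    by rewrite mulr1 lerDl (le_trans C0).
  apply: mx_le_mul; last exact: mx_le_perm.
  apply: k_le; apply: (@mx_le_block F 1 n 1 n) => //; try exact: mx_le_1; try exact: mx_le_0.
  - by apply: mx_le_scalar1; apply: le_2C.
  - by apply: mx_le_trans k2_le; rewrite lerDr.
- move=> i j; apply: (@le_trans _ _ (n.+1%:R * (1 * Ck))); last first.
    by rewrite mul1r lerDl (le_trans C0).
  apply: mx_le_mul; first exact: mx_le_perm.
  apply: k_le; apply: (@mx_le_block F 1 n 1 n) => //; try exact: mx_le_1; try exact: mx_le_0; try exact: leN.
  - by apply: mx_le_scalar1; apply: le_2C; rewrite (le_trans ba_le)// ler1n.
  - by apply: mx_le_trans k2'_le; rewrite lerDr.
Qed.
End PivotedReduction.

Lemma mx_le_det (F : realFieldType) n (c : F) (A : 'M[F]_n) : mx_le c A ->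
  `|\det A| <= n`!%:R * c ^+ n.
Proof.
move=> Ac; rewrite /determinant (le_trans (ler_norm_sum _ _ _))//.
rewrite -card_Sn -sum1_card natr_sum mulr_suml ler_sum// => s _.
rewrite mul1r normrM normrX normrN1 expr1n mul1r normr_prod.
rewrite -[X in c ^+ X]card_ord -prodr_const.
by apply: ler_prod => i _; rewrite normr_ge0 Ac.
Qed.

(** * Counting in one column lattice *)

Definition ratmx m n (A : 'M[int]_(m, n)) : 'M[rat]_(m, n) := map_mx intr A.

(** The conclusion of [pivoted_reduction]: A is diag(b) G^-1 k up to a row
    permutation, where k and its inverse k' are bounded. *)
Definition reduces n (c Z : rat) (s : 'S_n) (p : 'I_n -> nat) (A : 'M[rat]_n)
    (G : 'M[int]_n) (k k' : 'M[rat]_n) :=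
  let b i := Z / 2 ^+ p i in
  [/\ [/\ is_trig_mx G, forall i, G i i = 1 &
          forall i j, `|(G i j)%:~R| * b i <= c * b j],
      ratmx G *m diag_mx (\row_i (b i)^-1) *m perm_mx s *m A = k,
      k *m k' = 1%:M, mx_le c k & mx_le c k'].

Lemma norm_intr_le (F : realFieldType) (x : int) (c : nat) :
  (`|x%:~R : F| <= c%:R) = (absz x <= c)%N.
Proof. by rewrite -intr_norm -[c%:R]/((c%:Z)%:~R) ler_int -abszE lez_nat. Qed.

Lemma ler_cross (F : realFieldType) (x y z u w : F) : 0 < z -> 0 < u -> 0 < w ->
  x * (z / u) <= y * (z / w) -> x * w <= y * u.
Proof.
move=> z0 u0 w0.
have -> : x * (z / u) = x * w * (z / (u * w)) by field; rewrite !gt_eqF.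
have -> : y * (z / w) = y * u * (z / (u * w)) by field; rewrite !gt_eqF.
by rewrite ler_pM2r// divr_gt0// mulr_gt0.
Qed.

Lemma ratmxM m n p (A : 'M[int]_(m, n)) (B : 'M[int]_(n, p)) : ratmx (A *m B) = ratmx A *m ratmx B.
Proof. exact: map_mxM. Qed.

Lemma det_ratmx n (A : 'M[int]_n) : \det (ratmx A) = (\det A)%:~R.
Proof. exact: det_map_mx. Qed.

Lemma count_bounded_quotients n (c : nat) (S : seq 'M[int]_n) (U : 'M[int]_n -> 'M[int]_n) :
  uniq S -> {in S &, injective U} -> {in S, forall A, mx_le c%:R (ratmx (U A))} ->
  (size S <= (2 * c).+1 ^ (n * n))%N.
Proof.
move=> uniqS U_inj U_le.
have := @seq_count _ _ (fun (ij : 'I_n * 'I_n) A => U A ij.1 ij.2)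
  (fun=> (2 * c).+1) 1 (enum {: 'I_n * 'I_n}) S.
rewrite mul1n big_const_seq count_predT iter_muln_1 -cardE card_prod card_ord.
apply => [cs1 [i j] cs2 _ A A' AS A'S _ | S' sub_S' eq_S'].
  have := U_le A AS i j; have := U_le A' A'S i j.
  by rewrite /ratmx !mxE !norm_intr_le /=; lia.
case: S' sub_S' eq_S' => [|A [|A' S']]//= sub_S' eq_S'.
have AS : A \in S by rewrite (mem_subseq sub_S')// mem_head.
have A'S : A' \in S by rewrite (mem_subseq sub_S')// !inE eqxx orbT.
have eqA : A = A'.
  apply: U_inj => //; apply/matrixP => i j.
  by apply: (eq_S' A A' _ _ (i, j)); rewrite ?mem_enum// !inE eqxx ?orbT.
by have := subseq_uniq sub_S' uniqS; rewrite eqA /= mem_head.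
Qed.

(** The integer matrices G are counted column by column, from the last column to
    the first. Let T be a lower triangular form of M. The entries of
    G diag(b)^-1 T are O(N), since this matrix is k B up to a bounded factor.
    Once the later columns of G are known, the entry (i, j) of this product
    determines G i j up to N b_j / |T j j|; the reduction itself bounds G i j by
    b_j / b_i. With 2^(r j) of the order of N Z / |T j j|, these two bounds are
    2^(r j - p j) and 2^(p i - p j). Matrices A with the same G differ by the
    bounded integer matrix k1^-1 k. *)
Lemma count_same_scales n (c : nat) : (0 < c)%N -> exists C : nat,
  forall (N : nat) (Z : rat) (M : 'M[int]_n) s p (S : seq 'M[int]_n),
  (0 < N)%N -> 0 < Z -> \det M != 0 -> uniq S -> S != [::] ->
  {in S, forall A, exists B G k k', [/\ A *m B = M, mx_le N%:R (ratmx B) &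
                                       reduces c%:R Z s p (ratmx A) G k k']} ->
  {in S &, forall A A', exists U, A' = A *m U} ->
  exists r : 'I_n -> nat,
    [/\ (size S <= C * \prod_i \prod_j 2 ^ (minn (p i) (r j) - p j))%N,
        forall j, (p j <= r j)%N &
        (2 ^ (\sum_j r j) * absz (\det M))%:R <= (C%:R * N%:R * Z) ^+ n].
Proof.
move=> c_gt0; have [c1 c1_ge1 col_red] := @column_reduction rat n.
pose K0 : rat := n%:R * (n%:R * c%:R * c1) + 1.
have K0_ge1 : 1 <= K0 by rewrite lerDr !mulr_ge0// (le_trans ler01).
pose Cb := Num.bound (2 * K0).
have Cb_ge : 2 * K0 <= Cb%:R by rewrite ltW// archi_boundP// mulr_ge0// (le_trans ler01).
pose c6 := (2 * (n * (c * c))).+1.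
pose c5 := (2 * c).+1.
exists (c6 ^ (n * n) * c5 ^ (n * n) + Cb)%N.
move=> N Z M s p S N_gt0 Z_gt0 detM uniqS S_neq0 redS classS.
pose data_spec A (d : 'M[int]_n * 'M[int]_n * 'M[rat]_n * 'M[rat]_n) := A \in S ->
  [/\ A *m d.1.1.1 = M, mx_le N%:R (ratmx d.1.1.1) &
      reduces c%:R Z s p (ratmx A) d.1.1.2 d.1.2 d.2].
have [data dataP] : {data & forall A, data_spec A (data A)}.
  apply: choice => A; have [AS|AnS] := boolP (A \in S).
    by have [B [G [k [k' ?]]]] := redS A AS; exists (B, G, k, k').
  by exists (0, 0, 0, 0); rewrite /data_spec (negPf AnS).
pose B A := (data A).1.1.1; pose G A := (data A).1.1.2.
pose k A := (data A).1.2; pose k' A := (data A).2.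
pose b i := Z / 2 ^+ p i.
have b_gt0 i : 0 < b i by rewrite divr_gt0// exprn_gt0.
pose Db : 'M[rat]_n := diag_mx (\row_i (b i)^-1).
pose M1 := perm_mx s *m ratmx M.
have detM1 : `|\det M1| = (absz (\det M))%:R.
  by rewrite det_mulmx det_perm normrM normrX normrN1 expr1n mul1r det_ratmx -intr_norm.
have [V [V_le detV trigT]] : exists V : 'M[rat]_n, [/\ mx_le c1 V, `|\det V| = 1 & is_trig_mx (M1 *m V)].
  by apply: col_red; rewrite -normr_eq0 detM1 pnatr_eq0 absz_eq0.
set T := M1 *m V in trigT.
have trigT' : forall i j : 'I_n, (i < j)%N -> T i j = 0 by apply/is_trig_mxP.
pose K := K0 * N%:R.
have K_gt0 : 0 < K by rewrite mulr_gt0 ?ltr0n// (lt_le_trans ltr01).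
have GT A : A \in S -> ratmx (G A) *m Db *m T = k A *m ratmx (B A) *m V.
  move=> AS; have [AB _ [_ defk _ _ _]] := dataP A AS.
  by rewrite /k -defk -/(G A) /T /M1 -AB ratmxM !mulmxA.
have GT_le A : A \in S -> mx_le K (ratmx (G A) *m Db *m T).
  move=> AS; have [AB B_le [_ _ _ k_le _]] := dataP A AS.
  rewrite GT//; apply: mx_le_trans (mx_le_mul (mx_le_mul k_le B_le) V_le).
  rewrite /K /K0 mulrDl mul1r.
  rewrite (_ : n%:R * (n%:R * (c%:R * N%:R) * c1) = n%:R * (n%:R * c%:R * c1) * N%:R); last by ring.
  by rewrite lerDl.
have DbT j l : (Db *m T) j l = (b j)^-1 * T j l by rewrite mul_diag_mx !mxE.
have G_red A : A \in S -> [/\ forall i j : 'I_n, (i < j)%N -> G A i j = 0,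
    forall i, G A i i = 1 & forall i j, `|(G A i j)%:~R| * b i <= c%:R * b j].
  by move=> AS; have [_ _ [[/is_trig_mxP]]] := dataP A AS.
have bE j : b j = Z / 2 ^+ p j by [].
clearbody b.
have prodT : \prod_j `|T j j| = (absz (\det M))%:R.
  by rewrite -normr_prod -det_trig// det_mulmx normrM detV mulr1.
have T_neq0 j : 0 < `|T j j|.
  rewrite normr_gt0; apply: contraNneq detM => Tj0.
  by rewrite -absz_eq0 -(pnatr_eq0 rat) -prodT (bigD1 j)//= Tj0 normr0 mul0r.
have /hasP[A0 A0S _] : has predT S by rewrite has_predT lt0n size_eq0.
have T_le j : `|T j j| <= K * b j.
  have := GT_le A0 A0S j j; rewrite -mulmxA mxE (bigD1 j)//= big1 => [|l lj].
    have [_ diagG _] := G_red A0 A0S.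
    rewrite addr0 DbT mxE diagG mul1r normrM normfV (gtr0_norm (b_gt0 j)) mulrC.
    by rewrite ler_pdivrMr.
  have [trigG _ _] := G_red A0 A0S.
  have [jl|le_lj] := ltnP j l; first by rewrite mxE trigG// mulr0z mul0r.
  rewrite DbT trigT' ?mulr0// ltn_neqAle le_lj andbT.
  by rewrite val_eqE lj.
have b_le j : b j <= Z.
  by rewrite bE ler_pdivrMr ?exprn_gt0// ler_peMr ?(ltW Z_gt0)// exprn_ege1// ler1n.
have [r rP] : exists r : 'I_n -> nat, forall j,
    K * Z <= `|T j j| * 2 ^+ r j /\ `|T j j| * 2 ^+ r j < 2 * (K * Z).
  apply: (@fin_all_exists _ (fun=> nat) (fun j q =>
    K * Z <= `|T j j| * 2 ^+ q /\ `|T j j| * 2 ^+ q < 2 * (K * Z))) => j.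
  have [|q [q_le lt_q]] := @dyadic_below rat (K * Z) _ (T_neq0 j).
    by rewrite (le_trans (T_le j))// ler_pM2l.
  have q_gt0 : 0 < 2 ^+ q :> rat by rewrite exprn_gt0.
  exists q; split; first by rewrite -ler_pdivrMr.
  by rewrite -ltr_pdivlMr// -mulrA.
have p_le_r j : (p j <= r j)%N.
  have [rj _] := rP j.
  rewrite -(@leq_exp2l 2)// -(ler_nat rat) !natrX.
  have := le_trans rj (ler_wpM2r (exprn_ge0 _ (ler0n _ 2)) (T_le j)).
  rewrite -[K * b j * _]mulrA (ler_pM2l K_gt0) bE mulrAC ler_pdivlMr ?exprn_gt0//.
  by rewrite ler_pM2l.
exists r; split=> //; last first.
  have -> : (2 ^ (\sum_j r j) * absz (\det M))%:R = \prod_j (`|T j j| * 2 ^+ r j) :> rat.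
    by rewrite natrM natrX -prodT expr_sum -big_split/=; apply: eq_bigr => j _; rewrite mulrC.
  apply: (@le_trans _ _ (\prod_(j < n) (2 * (K * Z)))).
    by apply: ler_prod => j _; have [_ /ltW->] := rP j; rewrite mulr_ge0 ?exprn_ge0.
  rewrite prodr_const card_ord; apply: lerXn2r; rewrite ?nnegrE.
  - by apply: mulr_ge0 => //; apply/ltW/mulr_gt0.
  - by rewrite !mulr_ge0// ltW.
  - rewrite /K !mulrA (ler_pM2r Z_gt0) ler_pM2r ?ltr0n// (le_trans Cb_ge)// ler_nat.
    exact: leq_addl.
(* In this order the columns to the right of an entry of G are known before it. *)
pose cs := sort (fun x y : 'I_n * 'I_n => (y.2 <= x.2)%N) (enum {: 'I_n * 'I_n}).
pose l (ij : 'I_n * 'I_n) := (c5 * 2 ^ (minn (p ij.1) (r ij.2) - p ij.2))%N.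
have := @seq_count _ _ (fun (ij : 'I_n * 'I_n) A => G A ij.1 ij.2) l (c6 ^ (n * n)) cs S.
have -> : (\prod_(ij <- cs) l ij = c5 ^ (n * n) * \prod_i \prod_j 2 ^ (minn (p i) (r j) - p j))%N.
  rewrite (perm_big (enum {: 'I_n * 'I_n})) ?perm_sort//= big_enum/=.
  rewrite big_split/= prod_nat_const card_prod card_ord; congr (_ * _)%N.
  by rewrite -(pair_bigA _ (fun i j => 2 ^ (minn (p i) (r j) - p j))%N).
rewrite mulnA => count; apply: (leq_trans (count _ _)); last by rewrite leq_mul2r leq_addr orbT.
- move=> cs1 [i j] cs2 cs_eq A A' AS A'S eq_cs1 /=.
  have eq_later (i' j' : 'I_n) : (j < j')%N -> G A i' j' = G A' i' j'.
    move=> jj'; apply: (eq_cs1 (i', j')).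
    have leT_tr : transitive (fun x y : 'I_n * 'I_n => (y.2 <= x.2)%N).
      by move=> x y w xy wx; apply: leq_trans xy.
    have /cat_sorted2[_ /= /(order_path_min leT_tr)/allP cs2_le] : sorted (fun x y : 'I_n * 'I_n => (y.2 <= x.2)%N) (cs1 ++ (i, j) :: cs2).
      by rewrite -cs_eq; apply: sort_sorted => x y; apply: leq_total.
    have : (i', j') \in cs by rewrite mem_sort mem_enum.
    rewrite cs_eq mem_cat => /orP[//|]; rewrite inE => /predU1P[[_ jE]|/cs2_le/=].
      by rewrite jE ltnn in jj'.
    by rewrite leqNgt jj'.
  have [trigG diagG G_le] := G_red A AS; have [trigG' diagG' G'_le] := G_red A' A'S.
  set q := minn (p i) (r j).
  have l_gt0 : (0 < c5 * 2 ^ (q - p j))%N by rewrite muln_gt0 expn_gt0.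
  have [ij|ji|/val_inj eq_ij] := ssrnat.ltngtP i j.
  - by rewrite trigG// trigG'// subrr.
  - set d := G A i j - G A' i j.
    have two_gt0 e : 0 < 2 ^+ e :> rat by rewrite exprn_gt0.
    (* From the bound for |G i j| by c b_j / b_i. *)
    have d_p : (2 ^ p j * absz d <= (2 * c) * 2 ^ p i)%N.
      have : `|d%:~R| * b i <= (2 * c)%:R * b j.
        rewrite /d intrB natrM mulr_natl mulr2n mulrDl.
        apply: le_trans (lerD (G_le i j) (G'_le i j)).
        by rewrite -mulrDl ler_wpM2r ?ler_normB// ltW.
      rewrite !bE => /(ler_cross Z_gt0 (two_gt0 _) (two_gt0 _)).
      rewrite -intr_norm -abszE -[_%:~R]/(_%:R) -!natrX -!natrM ler_nat.
      by rewrite mulnC.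
    (* From the entry (i, j) of G Db T: in the difference for A and A' the terms
       of the later columns cancel, and those of the earlier ones vanish because
       T is lower triangular. *)
    have d_r : (2 ^ p j * absz d <= (2 * c) * 2 ^ r j)%N.
      have dT : `|d%:~R| * `|T j j| <= 2 * K * b j.
        have GTE A1 : (ratmx (G A1) *m Db *m T) i j = \sum_l0 (G A1 i l0)%:~R * ((b l0)^-1 * T l0 j).
          by rewrite -mulmxA mxE; apply: eq_bigr => l0 _; rewrite DbT mxE.
        have dE : (ratmx (G A) *m Db *m T) i j - (ratmx (G A') *m Db *m T) i j = d%:~R * ((b j)^-1 * T j j).
          rewrite !GTE -sumrB (bigD1 j)//= big1 ?addr0 => [|l0 l0j].
            by rewrite -mulrBl intrB.
          have [jl|le_lj] := ltnP j l0; first by rewrite eq_later// subrr.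
          by rewrite trigT' ?mulr0 ?subrr// ltn_neqAle le_lj andbT val_eqE.
        have : `|d%:~R * ((b j)^-1 * T j j)| <= 2 * K.
          rewrite -dE mulr_natl mulr2n (le_trans (ler_normB _ _))// lerD// GT_le//.
        rewrite !normrM normfV (gtr0_norm (b_gt0 j)) mulrCA mulrC.
        by rewrite ler_pdivrMr.
      have [KZ_le _] := rP j.
      have : `|d%:~R| * (K * Z) <= 2 * K * b j * 2 ^+ r j.
        apply: (@le_trans _ _ (`|d%:~R| * (`|T j j| * 2 ^+ r j))).
          by rewrite ler_wpM2l.
        by rewrite mulrA ler_pM2r.
      rewrite bE.
      have -> : 2 * K * (Z / 2 ^+ p j) * 2 ^+ r j = 2 * 2 ^+ r j / 2 ^+ p j * (K * Z) by ring.
      rewrite (ler_pM2r (mulr_gt0 K_gt0 Z_gt0)) (ler_pdivlMr _ _ (two_gt0 _)) -intr_norm -abszE -[_%:~R]/(_%:R).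
      rewrite -!natrX -!natrM ler_nat mulnC => /leq_trans; apply.
      by rewrite leq_mul2r -[X in (X <= _)%N]muln1 leq_mul2l c_gt0 !orbT.
    have d_q : (2 ^ p j * absz d <= (2 * c) * 2 ^ q)%N.
      by rewrite /q; case: (leqP (p i) (r j)).
    have : (absz d <= (2 * c) * 2 ^ (q - p j))%N.
      have [pq|qp] := leqP (p j) q.
        by move: d_q; rewrite -{1}(subnKC pq) expnD mulnCA leq_pmul2l ?expn_gt0.
      rewrite (eqP (ltnW qp)) muln1 -(@leq_pmul2l (2 ^ p j)%N) ?expn_gt0//.
      by rewrite (leq_trans d_q)// mulnC leq_mul2r leq_pexp2l ?orbT// ltnW.
    move=> /leq_ltn_trans; apply.
    by rewrite /l/= ltn_pmul2r ?expn_gt0.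
  - by rewrite /l /= -/q eq_ij diagG diagG' subrr.
- move=> S' sub_S' eq_S'.
  have [->//|] := eqVneq S' [::]; case: S' sub_S' eq_S' => // A1 S1 sub_S' eq_S' _.
  have inS A : A \in A1 :: S1 -> A \in S by apply: mem_subseq sub_S' A.
  have A1S : A1 \in S by apply: inS; apply: mem_head.
  pose quotient_spec A U := A \in S -> A = A1 *m U.
  have [U UP] : {U & forall A, quotient_spec A (U A)}.
    apply: choice => A; have [AS|AnS] := boolP (A \in S); last first.
      by exists 0; rewrite /quotient_spec (negPf AnS).
    by have [U ?] := classS A1 A A1S AS; exists U.
  apply: (@count_bounded_quotients n (n * (c * c)) _ U); first exact: subseq_uniq sub_S' uniqS.
    by move=> A A' /inS AS /inS A'S eqU; rewrite (UP A AS) (UP A' A'S) eqU.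
  move=> A A_in; have AS := inS A A_in.
  have GA : G A = G A1.
    apply/matrixP => i j; apply: (eq_S' A A1 A_in (mem_head _ _) (i, j)).
    by rewrite mem_sort mem_enum.
  have [_ _ [_ kA kkA kA_le _]] := dataP A AS.
  have [_ _ [_ kA1 kkA1 _ kA1_le]] := dataP A1 A1S.
  have kU : k A = k A1 *m ratmx (U A).
    by rewrite /k -kA -kA1 -/(G A) -/(G A1) GA {1}(UP A AS) ratmxM !mulmxA.
  have -> : ratmx (U A) = k' A1 *m k A.
    by rewrite kU mulmxA (mulmx1C kkA1) mul1mx.
  by rewrite natrM natrM; apply: mx_le_mul.
Qed.

(** As |det A| >= 1 and det k is bounded, the product of the b_i is bounded from
    below. None of them exceeds Z, so none of them is small. *)
Lemma reduces_scale n (c : nat) (N : nat) s p (A : 'M[int]_n) G k k' :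
  (0 < N)%N -> \det A != 0 ->
  reduces c%:R (4 ^+ n * N%:R) s p (ratmx A) G k k' ->
  forall i, (2 ^ p i <= n`! * c ^ n * (4 ^ n * N) ^ n)%N.
Proof.
move=> N_gt0 detA [[trigG diagG _] defk _ k_le _] i.
set Z := 4 ^+ n * N%:R in defk.
have Z_gt0 : 0 < Z by rewrite mulr_gt0 ?exprn_gt0 ?ltr0n.
have two_gt0 e : 0 < 2 ^+ e :> rat by rewrite exprn_gt0.
have [b bE] : exists b, forall j, b j = Z / 2 ^+ p j by eexists.
have b_gt0 j : 0 < b j by rewrite bE divr_gt0.
have detG : \det (ratmx G) = 1.
  by rewrite det_ratmx det_trig// big1.
have det_k : `|\det k| = (\prod_j b j)^-1 * (absz (\det A))%:R.
  rewrite -defk !det_mulmx detG mul1r det_diag det_perm !normrM normrX normrN1 expr1n mulr1.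
  rewrite det_ratmx -intr_norm; congr (_ * _).
  rewrite -prodfV normr_prod; apply: eq_bigr => j _.
  by rewrite mxE -bE gtr0_norm// invr_gt0.
have prod_gt0 : 0 < \prod_j b j by apply: prodr_gt0.
have one_le : 1 <= n`!%:R * c%:R ^+ n * \prod_j b j.
  have := mx_le_det k_le; rewrite det_k mulrC ler_pdivrMr//; apply: le_trans.
  by rewrite ler1n absz_gt0.
have b_prod : (\prod_j b j) * 2 ^+ p i <= Z ^+ n.
  rewrite (bigD1 i)//= bE mulrAC divfK ?gt_eqF//.
  rewrite -[in X in _ <= X](card_ord n) -prodr_const [leRHS](bigD1 i)//=.
  rewrite ler_pM2l//; apply: ler_prod => j _; rewrite ltW//= bE.
  by rewrite ler_pdivrMr// ler_peMr ?(ltW Z_gt0)// exprn_ege1// ler1n.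
rewrite -(ler_nat rat) natrX.
apply: (@le_trans _ _ (n`!%:R * c%:R ^+ n * (\prod_j b j) * 2 ^+ p i)).
  by rewrite ler_peMl// ltW.
by rewrite !natrM !natrX natrM natrX -mulrA ler_wpM2l ?mulr_ge0 ?exprn_ge0.
Qed.

(** By [reduces_scale] the exponents p i are O(log N), so the choice of the row
    permutation and of the scales costs only a power of log N; here P stands for
    the logarithm. For fixed scales, [count_same_scales] bounds the number of
    matrices by 2 to a power that [sum_minn_le] compares with the sum of the
    r j, and 2^(sum r) is at most N^(2n) / D up to a constant. *)
Lemma count_class n : (0 < n)%N -> exists C : nat,
  forall (N : nat) (M : 'M[int]_n) (S : seq 'M[int]_n),
  (0 < N)%N -> \det M != 0 -> uniq S ->
  {in S, forall A, mx_le N%:R (ratmx A) /\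
     exists2 B, A *m B = M & mx_le N%:R (ratmx B)} ->
  {in S &, forall A A', exists U, A' = A *m U} ->
  exists2 P, (2 ^ P <= C * N ^ n)%N &
    (size S ^ n * absz (\det M) ^ (n ^ 2 %/ 4) <=
       C * P.+1 ^ (n * n) * N ^ (2 * n * (n ^ 2 %/ 4)))%N.
Proof.
move=> n_gt0; have [c0 c0_ge1 red] := @pivoted_reduction rat n.
have [c c_ge c_gt0] : exists2 c : nat, c0 <= c%:R & (0 < c)%N.
  exists (Num.bound c0); first by rewrite ltW// archi_boundP// (le_trans ler01).
  rewrite -(ltr0n rat) (lt_trans (lt_le_trans ltr01 c0_ge1))//.
  by rewrite archi_boundP// (le_trans ler01).
have [C7 same_scales] := @count_same_scales n c c_gt0.
set Sn := (n ^ 2 %/ 4)%N.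
pose Cp := (n`! * c ^ n * (4 ^ n) ^ n)%N.
exists ((n`! * C7) ^ n * (C7 * 4 ^ n) ^ (n * Sn) + Cp)%N.
move=> N M S N_gt0 detM uniqS S_bnd classS.
have Cp_gt0 : (0 < Cp)%N by rewrite !muln_gt0 fact_gt0 !expn_gt0 c_gt0.
have [->|S_neq0] := eqVneq S [::].
  exists 0%N; last by rewrite exp0n.
  by rewrite muln_gt0 expn_gt0 N_gt0 andbT (leq_trans Cp_gt0)// leq_addl.
pose Z : rat := 4 ^+ n * N%:R.
have Z_gt0 : 0 < Z by rewrite mulr_gt0 ?exprn_gt0 ?ltr0n.
pose red_spec A (d : 'S_n * ('I_n -> nat)) := A \in S ->
  exists B G k k', [/\ A *m B = M, mx_le N%:R (ratmx B) &
                      reduces c%:R Z d.1 d.2 (ratmx A) G k k'].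
have [d dP] : {d & forall A, red_spec A (d A)}.
  apply: choice => A; have [AS|AnS] := boolP (A \in S); last first.
    by exists (1%g, fun=> 0%N); rewrite /red_spec (negPf AnS).
  have [A_le [B AB B_le]] := S_bnd A AS.
  have detA : \det (ratmx A) != 0.
    rewrite det_ratmx intr_eq0; apply: contraNneq detM => detA.
    by rewrite -AB det_mulmx detA mul0r.
  have [s [p [G [k [k' /= [[trigG diagG G_le] defk kk k_le k'_le]]]]]] :=
    red (ratmx A) N%:R detA (ltac:(by rewrite ltr0n)) A_le.
  exists (s, p) => _; exists B, G, k, k'; split=> //; split=> //=; [split=> //| |].
  - move=> i j; apply: le_trans (G_le i j) _.
    by rewrite ler_wpM2r// divr_ge0 ?exprn_ge0// ltW.
  - exact: mx_le_trans k_le.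
  - exact: mx_le_trans k'_le.
pose W := (Cp * N ^ n)%N.
have W_gt0 : (0 < W)%N by rewrite muln_gt0 Cp_gt0 expn_gt0 N_gt0.
pose P := trunc_log 2 W.
have P_le : (2 ^ P <= W)%N by apply: trunc_logP.
have p_le A i : A \in S -> ((d A).2 i < P.+1)%N.
  move=> AS; have [B [G [k [k' [AB _ redA]]]]] := dP A AS.
  have detA : \det A != 0.
    by apply: contraNneq detM => detA; rewrite -AB det_mulmx detA mul0r.
  rewrite ltnS trunc_log_max// (leq_trans (reduces_scale N_gt0 detA redA i))//.
  by rewrite /W /Cp expnMn !mulnA.
exists P.
  by rewrite (leq_trans P_le)// /W leq_mul2r leq_addl orbT.
pose h A : 'S_n * {ffun 'I_n -> 'I_P.+1} := ((d A).1, [ffun i => inord ((d A).2 i)]).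
have [|v _ size_S] := @pigeonhole _ _ S h (enum {: 'S_n * {ffun 'I_n -> 'I_P.+1}}) _ S_neq0.
  by move=> A _; rewrite mem_enum.
set S' := [seq A <- S | h A == v] in size_S.
have S'_neq0 : S' != [::].
  by apply: contraTneq size_S => ->; rewrite muln0 leqn0 size_eq0.
have inS' A : A \in S' -> A \in S /\ d A = (v.1, (fun i => v.2 i : nat)).
  rewrite mem_filter => /andP[/eqP hA AS]; split=> //.
  rewrite [d A]surjective_pairing -hA/=; congr pair; apply: funext => i.
  by rewrite ffunE inordK// p_le.
pose p i : nat := v.2 i.
have [||||r [size_S' p_r r_le]] := same_scales N Z M v.1 p S' N_gt0 Z_gt0 detM.
- exact: filter_uniq.
- exact: S'_neq0.
- by move=> A /inS'[AS dA]; have := dP A AS; rewrite dA.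
- by move=> A A' /inS'[AS _] /inS'[A'S _]; apply: classS.
have {}r_le : (2 ^ (\sum_j r j) * absz (\det M) <= (C7 * 4 ^ n * N ^ 2) ^ n)%N.
  rewrite -(ler_nat rat) (le_trans r_le)// natrX !natrM !natrX /Z.
  by rewrite (_ : C7%:R * N%:R * _ = C7%:R * 4 ^+ n * N%:R ^+ 2)//; ring.
have card_h : size (enum {: 'S_n * {ffun 'I_n -> 'I_P.+1}}) = (n`! * P.+1 ^ n)%N.
  by rewrite -cardE card_prod card_Sn card_ffun !card_ord.
rewrite card_h in size_S.
set E := (\sum_i \sum_j (minn (p i) (r j) - p j))%N.
have prodE : (\prod_i \prod_j 2 ^ (minn (p i) (r j) - p j) = 2 ^ E)%N.
  by rewrite /E expn_sum; apply: eq_bigr => i _; rewrite expn_sum.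
(* Truncated subtraction of p j is subtraction of min(p i, p j), as p j <= r j. *)
have E_le : (n * E <= Sn * \sum_j r j)%N.
  have := sum_minn_le p r.
  have -> : (\sum_i \sum_j minn (p i) (r j) = E + \sum_i \sum_j minn (p i) (p j))%N.
    rewrite /E -big_split/=; apply: eq_bigr => i _; rewrite -big_split/=.
    by apply: eq_bigr => j _; have := p_r j; lia.
  by rewrite mulnDr addnC leq_add2l.
rewrite prodE in size_S'.
have size_Sn : (size S ^ n <= (n`! * C7) ^ n * P.+1 ^ (n * n) * 2 ^ (Sn * \sum_j r j))%N.
  apply: (@leq_trans ((n`! * P.+1 ^ n * (C7 * 2 ^ E)) ^ n)).
    by apply: leqXr; rewrite (leq_trans size_S)// leq_mul2l size_S' orbT.
  rewrite !expnMn -!expnM -!mulnA leq_mul2l; apply/orP; right.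
  rewrite mulnCA leq_mul2l; apply/orP; right; rewrite leq_mul2l; apply/orP; right.
  by rewrite leq_exp2l// mulnC.
apply: (@leq_trans ((n`! * C7) ^ n * P.+1 ^ (n * n) * (2 ^ (\sum_j r j) * absz (\det M)) ^ Sn)).
  rewrite [X in (_ <= _ * X)%N]expnMn -expnM [(_ * Sn)%N]mulnC mulnA leq_mul2r.
  by rewrite size_Sn orbT.
apply: (@leq_trans ((n`! * C7) ^ n * P.+1 ^ (n * n) * ((C7 * 4 ^ n * N ^ 2) ^ n) ^ Sn)).
  by rewrite leq_mul2l leqXr ?orbT.
have -> : (((C7 * 4 ^ n * N ^ 2) ^ n) ^ Sn = (C7 * 4 ^ n) ^ (n * Sn) * N ^ (2 * n * Sn))%N.
  by rewrite -expnM expnMn -[((N ^ 2) ^ _)%N]expnM mulnA.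
rewrite mulnA leq_mul2r; apply/orP; right.
by rewrite mulnAC leq_mul2r leq_addr orbT.
Qed.

(** * Counting factorizations *)

(** Equivalently, A and A' have the same column lattice. *)
Definition right_assoc n (A A' : 'M[int]_n) : bool :=
  `[< (exists U, A' = A *m U) /\ (exists U, A = A' *m U) >].

Lemma right_assoc_refl n (A : 'M[int]_n) : right_assoc A A.
Proof. by apply/asboolP; split; exists 1%:M; rewrite mulmx1. Qed.

Lemma right_assoc_sym n (A A' : 'M[int]_n) : right_assoc A A' = right_assoc A' A.
Proof. by apply/asboolP/asboolP => -[]. Qed.

Lemma right_assoc_trans n : transitive (@right_assoc n).
Proof.
move=> A' A A'' /asboolP[[U1 e1] [U2 e2]] /asboolP[[U3 e3] [U4 e4]]; apply/asboolP.
by split; [exists (U1 *m U3); rewrite mulmxA -e1 | exists (U4 *m U2); rewrite mulmxA -e4].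
Qed.

(** L consists of one representative of each class, and S' is a class of at
    least average size. *)
Lemma split_classes n (S : seq 'M[int]_n) : uniq S -> S != [::] ->
  exists L S', [/\ (size S <= size L * size S')%N, uniq L, uniq S',
    {subset L <= S} /\ {subset S' <= S} &
    ({in L &, forall A A', right_assoc A A' -> A = A'} /\
     {in S' &, forall A A', right_assoc A A'})].
Proof.
move=> uniqS S_neq0.
pose rep A := nth A S (find (right_assoc A) S).
have hasS A : A \in S -> has (right_assoc A) S.
  by move=> AS; apply/hasP; exists A => //; apply: right_assoc_refl.
have repS A : A \in S -> rep A \in S.
  by move=> AS; rewrite mem_nth// -has_find hasS.
have rep_assoc A : A \in S -> right_assoc A (rep A).
  by move=> AS; apply: nth_find; apply: hasS.
have rep_eq A A' : A \in S -> right_assoc A A' -> rep A = rep A'.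
  move=> AS AA'; rewrite /rep (@eq_find _ (right_assoc A) (right_assoc A')); last first.
    move=> X; apply/idP/idP; first by apply: right_assoc_trans; rewrite right_assoc_sym.
    exact: right_assoc_trans.
  apply: set_nth_default; rewrite -has_find.
  by apply/hasP; exists A => //; rewrite right_assoc_sym.
have [|v _ size_S] := @pigeonhole _ _ S rep (undup (map rep S)) _ S_neq0.
  by move=> A AS; rewrite mem_undup map_f.
exists (undup (map rep S)), [seq A <- S | rep A == v]; split=> //.
- exact: undup_uniq.
- exact: filter_uniq.
- split=> [X|A]; last by rewrite mem_filter => /andP[].
  by rewrite mem_undup => /mapP[A AS ->]; apply: repS.
split=> [A A'|A A'].
  rewrite !mem_undup => /mapP[A1 A1S ->] /mapP[A2 A2S ->] assoc12.
  apply: rep_eq => //; apply: right_assoc_trans (rep_assoc A1 A1S) _.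
  by apply: right_assoc_trans assoc12 _; rewrite right_assoc_sym rep_assoc.
rewrite !mem_filter => /andP[/eqP repA AS] /andP[/eqP repA' A'S].
apply: right_assoc_trans (rep_assoc A AS) _.
by rewrite repA -repA' right_assoc_sym rep_assoc.
Qed.

Lemma absz_det_le n (N : nat) (A : 'M[int]_n) : mx_le N%:R (ratmx A) ->
  (absz (\det A) <= n`! * N ^ n)%N.
Proof.
move=> /mx_le_det; rewrite det_ratmx -intr_norm -abszE -[_%:~R]/(_%:R).
by rewrite -natrX -natrM ler_nat.
Qed.

(** Besides the main exponent, the excess 3 n is made of 2 n for the divisor
    function of D << N^(2n), and of n for the powers of log N. *)
Lemma count_left_factors n q : (0 < n)%N -> exists C : nat,
  forall (N : nat) (M : 'M[int]_n) (S : seq 'M[int]_n),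
  (0 < N)%N -> \det M != 0 -> uniq S ->
  {in S, forall A, mx_le N%:R (ratmx A) /\
     exists2 B, A *m B = M & mx_le N%:R (ratmx B)} ->
  (size S ^ (n * q) <= C * N ^ (n * q * (2 * (n ^ 2 %/ 4)) + 3 * n))%N.
Proof.
move=> n_gt0; have [Cc class_bound] := count_class n_gt0.
have [Cd ndiv_le] := ndiv_bound (2 * (n * n) * q).
set Sn := (n ^ 2 %/ 4)%N in class_bound *.
pose t := (n * n * q)%N.
exists ((Cd * (n`! * n`!)) * (Cc ^ q * (t`! * 2 ^ t * Cc)) + 1)%N.
move=> N M S N_gt0 detM uniqS S_bnd.
have [->|S_neq0] := eqVneq S [::].
  case: (posnP q) => [->|q_gt0]; last by rewrite exp0n// muln_gt0 n_gt0.
  by rewrite muln0 expn0 muln_gt0 expn_gt0 N_gt0 addn1.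
have [L [S' [size_S uniqL uniqS' [subL subS'] [L_ineq S'_assoc]]]] := split_classes uniqS S_neq0.
set D := absz (\det M).
have D_gt0 : (0 < D)%N by rewrite absz_gt0.
have L_le : (size L ^ n <= ndiv D ^ (2 * (n * n)) * D ^ Sn)%N.
  apply: count_divisor_classes => //.
    by move=> A /subL/S_bnd[_ [B AB _]]; exists B.
  by move=> A A' AL A'L H1 H2; apply: L_ineq => //; apply/asboolP.
have [|A A' AS A'S|P P_le S'_le] := class_bound N M S' N_gt0 detM uniqS'.
  by move=> A /subS'/S_bnd.
  by have /asboolP[] := S'_assoc A A' AS A'S.
have D_le : (D <= n`! * n`! * N ^ (2 * n))%N.
  case: S S_neq0 S_bnd {uniqS size_S subL subS'} => // A S _ /(_ A (mem_head _ _))[A_le [B AB B_le]].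
  rewrite /D -AB det_mulmx abszM.
  apply: leq_trans (leq_mul (absz_det_le A_le) (absz_det_le B_le)) _.
  by rewrite mul2n -addnn expnD mulnACA.
have size_n : (size S ^ n <= ndiv D ^ (2 * (n * n)) * (Cc * P.+1 ^ (n * n) * N ^ (2 * n * Sn)))%N.
  apply: leq_trans (leqXr n size_S) _; rewrite expnMn.
  apply: leq_trans (leq_mul L_le (leqnn _)) _.
  by rewrite -mulnA leq_mul2l [(_ ^ Sn * _)%N]mulnC S'_le orbT.
have ndiv_q : (ndiv D ^ (2 * (n * n) * q) <= Cd * (n`! * n`!) * N ^ (2 * n))%N.
  by rewrite (leq_trans (ndiv_le _ D_gt0))// -mulnA leq_mul2l D_le orbT.
have P_q : (P.+1 ^ t <= t`! * 2 ^ t * Cc * N ^ n)%N.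
  rewrite (leq_trans (expS_le_exp2 _ _))// expnD -!mulnA leq_mul2l; apply/orP; right.
  by rewrite mulnC leq_mul2l P_le orbT.
rewrite expnM; apply: leq_trans (leqXr q size_n) _; rewrite !expnMn -!expnM.
apply: (@leq_trans ((Cd * (n`! * n`!) * N ^ (2 * n)) *
   (Cc ^ q * (t`! * 2 ^ t * Cc * N ^ n) * N ^ (2 * n * Sn * q)))).
  by rewrite leq_mul// leq_mul2r leq_mul2l P_q !orbT.
have -> : (n * q * (2 * Sn) + 3 * n = 2 * n + (n + 2 * n * Sn * q))%N by lia.
rewrite !expnD mulnDl; apply: leq_trans (leq_addr _ _).
apply: eq_leq; move: (N ^ (2 * n))%N (N ^ n)%N (N ^ _)%N (Cc ^ q)%N (2 ^ t)%N => a b c d e.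
by lia.
Qed.

Lemma half_sq n : (n ^ 2 %/ 2 = 2 * (n ^ 2 %/ 4))%N.
Proof.
set a := n./2; have [->|->] : n = (2 * a)%N \/ n = (2 * a).+1 by rewrite /a; lia.
  have -> : ((2 * a) ^ 2 = a * a * 4)%N by lia.
  by rewrite mulnK//; lia.
have -> : ((2 * a).+1 ^ 2 = (a * a + a) * 4 + 1)%N by lia.
by rewrite divnMDl//; lia.
Qed.

Lemma tau_le (R : realType) n q : (0 < n)%N -> exists C : nat,
  forall (T : R) (M : 'M[int]_n), \det M != 0 -> 1 <= T ->
  (tau T M ^ (n * q) <= C * absz (Num.floor T) ^ (n * q * (n ^ 2 %/ 2) + 3 * n))%N.
Proof.
move=> n_gt0; have [C count] := count_left_factors q n_gt0.
exists C => T M detM T_ge1; rewrite half_sq.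
have floor_ge1 : 1 <= Num.floor T by rewrite floor_ge_int.
set N := absz _.
have N_gt0 : (0 < N)%N by rewrite absz_gt0 gt_eqF// (lt_le_trans ltr01).
have NE : N%:Z = Num.floor T by rewrite gez0_abs// (le_trans ler01).
have fin := finite_factorizations T M.
have mx_leN (A : 'M[int]_n) : `|A|%:~R <= T -> mx_le N%:R (ratmx A).
  move=> /(int_mx_norm_leP _ (le_trans ler01 T_ge1)) A_le i j; rewrite mxE norm_intr_le.
  by have := A_le i j; rewrite -floor_ge_int -NE -abszE lez_nat.
have memS AB : AB \in fset_set (factorizations T M) ->
    [/\ `|AB.1|%:~R <= T, `|AB.2|%:~R <= T & AB.1 *m AB.2 = M].
  by rewrite in_fset_set// inE.
pose S := [seq AB.1 | AB <- fset_set (factorizations T M)].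
have -> : tau T M = size S by rewrite size_map.
apply: (count N M S) => //.
  rewrite /S map_inj_in_uniq ?fset_uniq// => -[A B] [A' B'].
  move=> /memS[_ _ /= AB] /memS[_ _ /= AB'] /= eqA; rewrite -{}eqA in AB' *.
  congr pair; apply/eqP; rewrite -subr_eq0; apply/eqP.
  have detA : \det (ratmx A) != 0.
    rewrite det_ratmx intr_eq0; apply: contraNneq detM => detA.
    by rewrite -AB det_mulmx detA mul0r.
  have : ratmx A *m ratmx (B - B') = 0.
    by rewrite -ratmxM mulmxBr AB AB' subrr /ratmx map_mx0.
  move=> /(congr1 (mulmx (invmx (ratmx A)))).
  rewrite mulmx0 mulKmx ?unitmxE ?unitfE// => /matrixP B0.
  by apply/matrixP => i j; have := B0 i j; rewrite !mxE => /eqP; rewrite intr_eq0 => /eqP.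
move=> _ /mapP[[A B] /memS[/= A_le B_le AB] ->]; split; first exact: mx_leN.
by exists B => //; apply: mx_leN.
Qed.

Theorem theorem1p3 (R : realType) (n : nat) (hn : (1 <= n)%N)
    (eps : R) (heps : 0 < eps) :
  exists2 C : R, 0 < C &
    forall (M : 'M[int]_n) (T : R), \det M != 0 -> 1 <= T ->
      (tau T M)%:R <= C * T `^ ((n ^ 2 %/ 2)%N%:R + eps).
Proof.
(* After extraction of the (n q)-th root, the excess 3 n in the exponent
   becomes 3 / q <= eps. *)
pose q := (Num.bound (3 / eps)).+1.
have q_eps : 3 <= q%:R * eps.
  rewrite -ler_pdivrMr// (@le_trans _ _ (Num.bound (3 / eps))%:R) ?ler_nat//.
  by rewrite ltW// archi_boundP// divr_ge0// ltW.
have [C0 tau_C0] := tau_le R q hn.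
exists C0.+1%:R => // M T detM T_ge1.
set k := (n * q)%N in tau_C0; set s := (n ^ 2 %/ 2)%N in tau_C0 *.
have k_gt0 : (0 < k)%N by rewrite muln_gt0 hn.
have T_ge0 : 0 <= T by rewrite (le_trans ler01).
have rhs_ge0 : 0 <= C0.+1%:R * T `^ (s%:R + eps) by rewrite mulr_ge0// powR_ge0.
rewrite -(ler_pXn2r k_gt0) ?nnegrE// -natrX.
have floor_le : (absz (Num.floor T))%:R <= T.
  have floor_ge0 : 0 <= Num.floor T by rewrite floor_ge0.
  by rewrite pmulrn gez0_abs// floor_le.
apply: (@le_trans _ _ (C0.+1%:R * T ^+ (k * s + 3 * n))).
  apply: (@le_trans _ _ (C0 * absz (Num.floor T) ^ (k * s + 3 * n))%:R).
    by rewrite ler_nat tau_C0.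
  rewrite natrM natrX ler_pM ?exprn_ge0 ?ler_nat//.
  by apply: lerXn2r; rewrite ?nnegrE.
rewrite exprMn; apply: ler_pM; rewrite ?exprn_ge0//.
  by rewrite ler_eXnr// ler1n.
rewrite -!powR_mulrn ?powR_ge0// -powRrM ler_powR//.
rewrite mulrDl natrD lerD ?natrM ?[s%:R * _]mulrC//.
rewrite [leLHS]mulrC mulrCA; apply: ler_wpM2l => //.
by rewrite mulrC.
Qed.
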